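(* Let $p,q$ be nonnegative integers, let $\kappa_1,\dots,\kappa_p,\mu_1,\dots,\mu_q$ be complex numbers none of which is in $\{0,-1,-2,\dots\}$, let $\alpha,\beta\in\mathbb{C}$ with $\Re(\alpha)>0$, and let $x,y,s\in\mathbb{C}$ with $\Re(x)>0$, $\Re(y)>0$, $\Re(s)>0$. Then the Laplace transform in $\rho$ of the M-beta function is $$\int_0^\infty e^{-s\rho}\;{}^{M}B_{p,q}^{(\alpha,\beta)}(\kappa_1,\dots,\kappa_p;\mu_1,\dots,\mu_q;x,y;\rho)\,d\rho=\frac{1}{s}\;{}^{M}B_{p+1,q}^{(\alpha,\beta)}\left( \kappa_{1},\ldots,\kappa_p,1;\mu_1,\ldots,\mu_q;x,y;\frac{1}{s}\right).$$
   Context: $(\lambda)_m=\Gamma(\lambda+m)/\Gamma(\lambda)$, $(\lambda)_0=1$ is the Pochhammer symbol. The generalized M-series is $${}_{p}^{\alpha}M^{\beta}_{q}(\kappa_{1},\ldots,\kappa_{p};\mu_{1},\ldots,\mu_{q};z)=\sum_{m=0}^{\infty}\frac{(\kappa_{1})_{m}\cdots(\kappa_p)_{m}}{(\mu_1)_{m}\cdots(\mu_q)_{m}}\frac{z^{m}}{\Gamma(\alpha m+\beta)}.$$ The modified beta (M-beta) function is $${}^{M}B_{p,q}^{(\alpha,\beta)}(\kappa_{1},\ldots,\kappa_p;\mu_1,\ldots,\mu_q;x,y;\rho)=\int_{0}^{1}t^{x-1}(1-t)^{y-1}\,{}_{p}^{\alpha}M^{\beta}_{q}\left(\kappa_{1},\ldots,\kappa_{p};\mu_{1},\ldots,\mu_{q};\frac{-\rho}{t(1-t)}\right)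 dt.$$ These functions are defined for those parameters and arguments for which the series and integrals converge. *)

(* Defs.v *)
From HB Require Import structures.
From mathcomp Require Import all_boot all_order all_algebra.
From mathcomp Require Import complex.
From mathcomp Require Import all_classical all_reals all_analysis.

Set Implicit Arguments.
Unset Strict Implicit.
Unset Printing Implicit Defensive.

Import Order.TTheory GRing.Theory Num.Theory.
Import numFieldNormedType.Exports.

Local Open Scope ring_scope.
Local Open Scope complex_scope.

Section complex_functions.
Variable R : realType.
Implicit Types (z w : R[i]) (t : R) (D : set R) (f : R -> R[i]).

Definition cexp z : R[i] :=
  (expR (complex.Re z))%:C * (cos (complex.Im z) +i* sin (complex.Im z)).

(* The principal power [t ^ z]; meaningful only for [0 < t], since [ln] is
   total with junk value [0] elsewhere. *)
Definition cpow t z : R[i] := cexp ((ln t)%:C * z).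

(* Gauss' limit for the entire function [1 / Gamma]:
     1 / Gamma z = lim_n z (z + 1) ... (z + n) / (n! n^z),
   valid on the whole complex plane.  The type [R[i]^o] carries the topology
   of the complex modulus. *)
Definition rGamma z : R[i] :=
  limn ((fun n : nat =>
    (\prod_(k < n.+1) (z + k%:R)) / (n`!%:R * cpow n%:R z)) : nat -> R[i]^o).

(* At the poles [0, -1, -2, ...] of Gamma this is [0^-1 = 0], so that
   [(Gamma z)^-1 = rGamma z] for every [z], with value [0] at the poles. *)
Definition Gamma z : R[i] := (rGamma z)^-1.

Definition pochhammer z (m : nat) : R[i] := Gamma (z + m%:R) / Gamma z.

(* Lebesgue integral of a complex-valued function of a real variable.
   Integrability of both components amounts to absolute integrability. *)
Definition cintegrable D f : Prop :=
  (@lebesgue_measure R).-integrable D (fun t => (complex.Re (f t))%:E) /\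
  (@lebesgue_measure R).-integrable D (fun t => (complex.Im (f t))%:E).

Definition cintegral D f : R[i] :=
  (\int[@lebesgue_measure R]_(t in D) complex.Re (f t)) +i*
  (\int[@lebesgue_measure R]_(t in D) complex.Im (f t)).

End complex_functions.

Section M_beta.
Variable R : realType.
Variables (alpha beta : R[i]) (kappa mu : seq R[i]).
Implicit Types (x y z rho : R[i]) (t : R).

Definition Mseries_term z (m : nat) : R[i]^o :=
  (\prod_(k <- kappa) pochhammer k m) / (\prod_(l <- mu) pochhammer l m)
  * (z ^+ m / Gamma (alpha * m%:R + beta)).

Definition Mseries_converges z : Prop := cvgn (series (Mseries_term z)).

Definition Mseries z : R[i] := limn (series (Mseries_term z)).

Definition Mbeta_arg rho t : R[i] := - rho / (t * (1 - t))%:C.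

Definition Mbeta_integrand x y rho t : R[i] :=
  cpow t (x - 1) * cpow (1 - t) (y - 1) * Mseries (Mbeta_arg rho t).

Definition Mbeta x y rho : R[i] :=
  cintegral `]0, 1[%classic (Mbeta_integrand x y rho).

(* [Mbeta] is total; this says that the series and the integral defining it
   at the given arguments converge. *)
Definition Mbeta_defined x y rho : Prop :=
  (forall t, 0 < t < 1 -> Mseries_converges (Mbeta_arg rho t)) /\
  cintegrable `]0, 1[%classic (Mbeta_integrand x y rho).

End M_beta.

(* Main.v *)
(** Since [1 / (t (1 - t))] is unbounded, convergence of the right-hand integrand
    makes [\sum_m a_m m! z^m] entire, where [M z = \sum_m a_m z^m].  Hence [M] grows
    slower than any exponential, and for fixed [t] its Laplace transform can be
    computed term by term, using [(1)_m = m!].  It remains to exchange the two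
    integrals.  With [phi v = |M (- v)|], scaling [rho = t (1 - t) v] and Tonelli turn
    the double integral of the modulus into [\int phi v * K v dv], with a kernel
    [K v <= 1], [K v = O (v^(- Re x - 1) + v^(- Re y - 1))]; and the substitution
    [v = 1 / (t (1 - t))] shows that convergence of the left-hand M-beta integral at
    [rho = 1] alone makes this finite. *)

Require Import Defs.
From HB Require Import structures.
From mathcomp Require Import all_boot all_order all_algebra.
From mathcomp Require Import complex.
From mathcomp Require Import all_classical all_reals all_analysis.
From mathcomp Require Import measurable_realfun.
From mathcomp Require Import ring lra.

Set Implicit Arguments.
Unset Strict Implicit.
Unset Printing Implicit Defensive.

Import Order.TTheory GRing.Theory Num.Theory.
Import numFieldNormedType.Exports.

Local Open Scope ring_scope.
Local Open Scope complex_scope.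
Local Open Scope classical_set_scope.

(** * Complex numbers *)

(** For fixed [t] the bound |M (- v)| <= C exp (c v) has to be used with c < Re s * t (1 - t), and
    nothing controls C as t tends to 0 or 1. The growth of M thus gives no domination in both
    variables, and finiteness of the double integral must come from convergence of the M-beta
    integral itself, which concerns one value of rho at a time. After the scaling, all values of rho
    involve the same function [phi] of one variable, so that one of them can control the others. The
    exponents of K come from the endpoints: near t = 0 the Jacobian leaves t^(Re x) exp (- Re s t
    v), whose integral is O(v^(- Re x - 1)), and near t = 1 the same holds with Re y. These are the
    weights that v = 1 / (t (1 - t)) produces: near t = 0 one has t ~ 1 / v, so t^(Re x - 1) dt
    becomes v^(- Re x - 1) dv up to sign. This map takes only values v >= 4; below 4, continuity of
    [phi] and K <= 1 are enough. *)

Notation cRe := complex.Re.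
Notation cIm := complex.Im.
Notation normc := ComplexField.Normc.normc.

Lemma Re_mul (R : realType) (z w : R[i]) :
  cRe (z * w) = cRe z * cRe w - cIm z * cIm w.
Proof. by case: z w => [a b] [c d]. Qed.

Lemma Im_mul (R : realType) (z w : R[i]) :
  cIm (z * w) = cRe z * cIm w + cIm z * cRe w.
Proof. by case: z w => [a b] [c d]. Qed.

Lemma ReD (R : realType) (z w : R[i]) : cRe (z + w) = cRe z + cRe w.
Proof. by case: z w => [a b] [c d]. Qed.

Lemma ImD (R : realType) (z w : R[i]) : cIm (z + w) = cIm z + cIm w.
Proof. by case: z w => [a b] [c d]. Qed.

Lemma ReN (R : realType) (z : R[i]) : cRe (- z) = - cRe z.
Proof. by case: z. Qed.

Lemma ImN (R : realType) (z : R[i]) : cIm (- z) = - cIm z.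
Proof. by case: z. Qed.

Lemma Re_sum (R : realType) (f : nat -> R[i]) (m n : nat) :
  cRe (\sum_(m <= k < n) f k) = \sum_(m <= k < n) cRe (f k).
Proof.
by apply: (big_ind2 (fun z r => cRe z = r)) => [||]// z a w b; rewrite ReD => -> ->.
Qed.

Lemma Im_sum (R : realType) (f : nat -> R[i]) (m n : nat) :
  cIm (\sum_(m <= k < n) f k) = \sum_(m <= k < n) cIm (f k).
Proof.
by apply: (big_ind2 (fun z r => cIm z = r)) => [||]// z a w b; rewrite ImD => -> ->.
Qed.

Lemma complex_eqP (R : realType) (z w : R[i]) :
  cRe z = cRe w -> cIm z = cIm w -> z = w.
Proof. by case: z w => [a b] [c d] /= -> ->. Qed.

Lemma normc_sqrt (R : realType) (z : R[i]) :
  normc z = Num.sqrt (cRe z ^+ 2 + cIm z ^+ 2).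
Proof. by case: z. Qed.

Lemma normc_ge0 (R : realType) (z : R[i]) : 0 <= normc z.
Proof. by rewrite normc_sqrt sqrtr_ge0. Qed.

Lemma le_Re_normc (R : realType) (z : R[i]) : `|cRe z| <= normc z.
Proof. by rewrite normc_sqrt -sqrtr_sqr ler_wsqrtr// lerDl sqr_ge0. Qed.

Lemma le_Im_normc (R : realType) (z : R[i]) : `|cIm z| <= normc z.
Proof. by rewrite normc_sqrt -sqrtr_sqr ler_wsqrtr// lerDr sqr_ge0. Qed.

Lemma normc_real (R : realType) (r : R) : normc r%:C = `|r|.
Proof. by rewrite normc_sqrt/= expr0n addr0 sqrtr_sqr. Qed.

Lemma normc_nat (R : realType) (n : nat) : normc (n%:R : R[i]) = n%:R.
Proof.
have -> : (n%:R : R[i]) = (n%:R : R)%:C by rewrite rmorph_nat.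
by rewrite normc_real normr_nat.
Qed.

Lemma normcD_le (R : realType) (z w : R[i]) : normc (z + w) <= normc z + normc w.
Proof. exact: le_normcD. Qed.

Lemma normc_le_ReIm (R : realType) (z : R[i]) :
  normc z <= `|cRe z| + `|cIm z|.
Proof.
have -> : `|cRe z| + `|cIm z| = normc (cRe z)%:C + normc (0 +i* cIm z).
  by rewrite normc_real normc_sqrt/= expr0n add0r sqrtr_sqr.
rewrite {1}(_ : z = (cRe z)%:C + (0 +i* cIm z)); first exact: normcD_le.
by case: z => a b /=; apply: complex_eqP => /=; rewrite ?addr0 ?add0r.
Qed.

Lemma normcX (R : realType) (z : R[i]) n : normc (z ^+ n) = normc z ^+ n.
Proof.
elim: n => [|n IH]; first by rewrite !expr0 ComplexField.Normc.normc1.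
by rewrite !exprS ComplexField.Normc.normcM IH.
Qed.

Lemma normc_sum_le (R : realType) (f : nat -> R[i]) n :
  normc (\sum_(0 <= k < n) f k) <= \sum_(0 <= k < n) normc (f k).
Proof.
elim: n => [|n IH]; first by rewrite !big_nil ComplexField.Normc.normc0.
rewrite !big_nat_recr//=; apply: le_trans (normcD_le _ _) _.
by rewrite lerD2r.
Qed.

Lemma Re_cexp (R : realType) (z : R[i]) :
  cRe (cexp z) = expR (cRe z) * cos (cIm z).
Proof. by rewrite /cexp Re_mul/= mul0r subr0. Qed.

Lemma Im_cexp (R : realType) (z : R[i]) :
  cIm (cexp z) = expR (cRe z) * sin (cIm z).
Proof. by rewrite /cexp Im_mul/= mul0r addr0. Qed.

Lemma normc_cexp (R : realType) (z : R[i]) : normc (cexp z) = expR (cRe z).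
Proof.
rewrite normc_sqrt Re_cexp Im_cexp !exprMn -mulrDr cos2Dsin2 mulr1.
by rewrite sqrtr_sqr ger0_norm// expR_ge0.
Qed.

Lemma normc_cpow (R : realType) (t : R) (z : R[i]) :
  normc (cpow t z) = expR (cRe z * ln t).
Proof. by rewrite normc_cexp Re_mul/= mul0r subr0 mulrC. Qed.

(** Series are summed in the topology of the modulus while integrals are taken by components; this
    is the passage from the first to the second. *)
Lemma cvg_ReIm (R : realType) (u : nat -> R[i]^o) (l : R[i]^o) :
  u @ \oo --> l ->
  cRe (u n) @[n --> \oo] --> cRe l /\ cIm (u n) @[n --> \oo] --> cIm l.
Proof.
move=> /cvgrPdist_lt ul; split; apply/cvgrPdist_lt => e e0.
  have e0' : (0 : R[i]) < e%:C by rewrite ltcR.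
  apply: filterS (ul _ e0') => n /=; rewrite normc_def ltcR -normc_sqrt.
  by apply: le_lt_trans; rewrite -ReN -ReD; exact: le_Re_normc.
have e0' : (0 : R[i]) < e%:C by rewrite ltcR.
apply: filterS (ul _ e0') => n /=; rewrite normc_def ltcR -normc_sqrt.
by apply: le_lt_trans; rewrite -ImN -ImD; exact: le_Im_normc.
Qed.

Lemma cvg_real_complex (R : realType) (u : nat -> R) (l : R) :
  u @ \oo --> l -> (fun n => (u n)%:C : R[i]^o) @ \oo --> (l%:C : R[i]^o).
Proof.
move=> /cvgrPdist_lt ul; apply/cvgrPdist_lt => e.
rewrite ltcE /= => /andP[/eqP e1 e0].
apply: filterS (ul _ e0) => n /= le.
by rewrite -rmorphB/= normc_def -normc_sqrt normc_real ltcE/= -e1 eqxx.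
Qed.

(** * Complex-valued integrals *)

Definition cmeasurable d (T : measurableType d) (R : realType) (D : set T)
    (f : T -> R[i]) : Prop :=
  measurable_fun D (fun t => cRe (f t)) /\
  measurable_fun D (fun t => cIm (f t)).

Lemma measurable_invr (R : realType) :
  measurable_fun [set: R] (fun x : R => x^-1).
Proof.
(* A composition of measurable functions that agrees with the inverse everywhere: at 0 the factor
   [x] gives the default value [0^-1 = 0], whatever [ln 0] is. *)
have -> : (fun x : R => x^-1) = (fun x => x * expR (- ln (x ^+ 2))).
  apply/funext => x; have [->|x0] := eqVneq x 0; first by rewrite invr0 mul0r.
  have x2 : 0 < x ^+ 2 by rewrite exprn_even_gt0.
  by rewrite expRN lnK ?posrE// expr2 invfM mulrA divff// mul1r.
apply: measurable_funM => //; apply: measurableT_comp => //.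
by apply: measurableT_comp => //; apply: measurableT_comp.
Qed.

Lemma measurable_cos (R : realType) : measurable_fun [set: R] (@cos R).
Proof. by apply: continuous_measurable_fun; exact: continuous_cos. Qed.

Lemma measurable_sin (R : realType) : measurable_fun [set: R] (@sin R).
Proof. by apply: continuous_measurable_fun; exact: continuous_sin. Qed.

Section cmeasurable_theory.
Context d (T : measurableType d) (R : realType) (D : set T).
Implicit Types f g : T -> R[i].

Lemma cmeasurable_cst (z : R[i]) : cmeasurable D (cst z).
Proof. by split; exact: measurable_cst. Qed.

Lemma cmeasurableM f g : cmeasurable D f -> cmeasurable D g ->
  cmeasurable D (fun t => f t * g t).
Proof.
move=> [f1 f2] [g1 g2]; split.
  under eq_fun do rewrite Re_mul.
  by apply: measurable_funB; exact: measurable_funM.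
under eq_fun do rewrite Im_mul.
by apply: measurable_funD; exact: measurable_funM.
Qed.

Lemma cmeasurable_real (h : T -> R) :
  measurable_fun D h -> cmeasurable D (fun t => (h t)%:C).
Proof. by move=> mh; split => //=; exact: measurable_cst. Qed.

Lemma cmeasurable_cexp f :
  cmeasurable D f -> cmeasurable D (fun t => cexp (f t)).
Proof.
move=> [f1 f2]; split.
  under eq_fun do rewrite Re_cexp.
  by apply: measurable_funM; [exact: (measurableT_comp (@measurable_expR R))|
    exact: (measurableT_comp (@measurable_cos R))].
under eq_fun do rewrite Im_cexp.
by apply: measurable_funM; [exact: (measurableT_comp (@measurable_expR R))|
    exact: (measurableT_comp (@measurable_sin R))].
Qed.

Lemma cmeasurable_cpow (h : T -> R) z :
  measurable_fun D h -> cmeasurable D (fun t => cpow (h t) z).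
Proof.
move=> mh; apply: cmeasurable_cexp; apply: cmeasurableM; last first.
  exact: cmeasurable_cst.
apply: cmeasurable_real.
exact: (measurableT_comp (@measurable_ln R)).
Qed.

Lemma measurable_normc f :
  cmeasurable D f -> measurable_fun D (fun t => normc (f t)).
Proof.
move=> [f1 f2]; under eq_fun do rewrite normc_sqrt.
apply: measurableT_comp.
  by apply: continuous_measurable_fun; exact: sqrt_continuous.
by apply: measurable_funD; exact: measurable_funX.
Qed.

End cmeasurable_theory.

Section cintegral_theory.
Context (R : realType) (D : set R) (mD : measurable D).
Implicit Types f g : R -> R[i].
Local Notation leb := (@lebesgue_measure R).

Lemma cintegrable_cmeasurable f : cintegrable D f -> cmeasurable D f.
Proof.
by move=> [/measurable_int/measurable_EFinP ? /measurable_int/measurable_EFinP].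
Qed.

Lemma cintegrable_dom f (g : R -> R) : cmeasurable D f ->
  leb.-integrable D (fun t => (g t)%:E) ->
  (forall t, D t -> normc (f t) <= g t) -> cintegrable D f.
Proof.
move=> [f1 f2] ig fg; split; apply: le_integrable ig => //=.
- apply/measurable_EFinP; assumption.
- move=> t Dt; rewrite lee_fin; apply: le_trans (ler_norm _).
  exact: le_trans (le_Re_normc _) (fg _ Dt).
- apply/measurable_EFinP; assumption.
- move=> t Dt; rewrite lee_fin; apply: le_trans (ler_norm _).
  exact: le_trans (le_Im_normc _) (fg _ Dt).
Qed.

Lemma cintegrable_normc f : cintegrable D f ->
  leb.-integrable D (fun t => (normc (f t))%:E).
Proof.
move=> fi; have [f1 f2] := fi.
suff : leb.-integrable D (fun t => `|(cRe (f t))%:E| + `|(cIm (f t))%:E|)%E.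
  apply: le_integrable => //.
    by apply/measurable_EFinP/measurable_normc/cintegrable_cmeasurable.
  move=> t Dt /=; rewrite lee_fin ger0_norm ?normc_ge0//.
  by apply: (le_trans (normc_le_ReIm _)); exact: ler_norm.
by apply: integrableD => //; exact: integrable_abse.
Qed.

Lemma eq_cintegrable f g : (forall t, D t -> f t = g t) ->
  cintegrable D f -> cintegrable D g.
Proof.
move=> fg [f1 f2]; split; [apply: eq_integrable f1|apply: eq_integrable f2] => //.
  by move=> t /set_mem Dt; rewrite fg.
by move=> t /set_mem Dt; rewrite fg.
Qed.

Lemma eq_cintegral f g : (forall t, D t -> f t = g t) ->
  cintegral D f = cintegral D g.
Proof.
move=> fg; rewrite /cintegral.
by congr (_ +i* _); apply: eq_Rintegral => t /set_mem Dt; rewrite fg.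
Qed.

Lemma cintegrableZ (c : R[i]) f : cintegrable D f ->
  cintegrable D (fun t => c * f t).
Proof.
move=> fi; apply: (@cintegrable_dom _ (fun t => normc c * normc (f t))).
- by apply: cmeasurableM; [exact: cmeasurable_cst|exact: cintegrable_cmeasurable].
- by under eq_fun do rewrite EFinM; apply: integrableZl => //; exact: cintegrable_normc.
- by move=> t _; rewrite ComplexField.Normc.normcM.
Qed.

Lemma cintegralZ (c : R[i]) f : cintegrable D f ->
  cintegral D (fun t => c * f t) = c * cintegral D f.
Proof.
move=> [f1 f2]; have Z r h : leb.-integrable D (EFin \o h) ->
    leb.-integrable D (EFin \o (fun t => r * h t)).
  move=> hi; rewrite (_ : _ \o _ = (fun t => r%:E * (EFin \o h) t)%E).
    exact: integrableZl.
  by apply/funext => t /=; rewrite EFinM.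
apply: complex_eqP => /=.
  under eq_Rintegral do rewrite Re_mul.
  by rewrite RintegralB ?RintegralZl ?Re_mul//; exact: Z.
under eq_Rintegral do rewrite Im_mul.
by rewrite RintegralD ?RintegralZl ?Im_mul//; exact: Z.
Qed.

Lemma cintegrableD f g : cintegrable D f -> cintegrable D g ->
  cintegrable D (fun t => f t + g t).
Proof.
move=> fi gi.
have [f1 f2] := cintegrable_cmeasurable fi.
have [g1 g2] := cintegrable_cmeasurable gi.
apply: (@cintegrable_dom _ (fun t => normc (f t) + normc (g t))).
- split; [under eq_fun do rewrite ReD|under eq_fun do rewrite ImD];
    exact: measurable_funD.
- under eq_fun do rewrite EFinD.
  by apply: integrableD => //; exact: cintegrable_normc.
- by move=> t _; exact: normcD_le.
Qed.

Lemma cintegralD f g : cintegrable D f -> cintegrable D g ->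
  cintegral D (fun t => f t + g t) = cintegral D f + cintegral D g.
Proof.
move=> [f1 f2] [g1 g2]; apply: complex_eqP; rewrite ?ReD ?ImD /=.
  by under eq_Rintegral do rewrite ReD; rewrite RintegralD.
by under eq_Rintegral do rewrite ImD; rewrite RintegralD.
Qed.

Lemma Rintegral_dominated (h_ : nat -> R -> R) (h g : R -> R) :
  (forall n, measurable_fun D (h_ n)) ->
  (forall t, D t -> h_ n t @[n --> \oo] --> h t) ->
  leb.-integrable D (fun t => (g t)%:E) ->
  (forall n t, D t -> `|h_ n t| <= g t) ->
  leb.-integrable D (fun t => (h t)%:E) /\
  \int[leb]_(t in D) h_ n t @[n --> \oo] --> \int[leb]_(t in D) h t.
Proof.
move=> mh ch ig hg.
have mh' : measurable_fun D h by apply: measurable_fun_cvg ch.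
have [] := @dominated_convergence _ _ _ leb D mD
  (fun n t => (h_ n t)%:E) (fun t => (h t)%:E) (fun t => (g t)%:E).
- by move=> n; apply/measurable_EFinP; exact: mh.
- by apply/measurable_EFinP; exact: mh'.
- apply/aeW => t Dt; apply/cvg_EFin; last exact: ch.
  exact: nearW.
- exact: ig.
- by apply/aeW => t n Dt; rewrite lee_fin; exact: hg.
move=> hi _ hc; split => //.
rewrite /Rintegral; apply: fine_cvg; rewrite fineK//.
exact: integrable_fin_num.
Qed.

Lemma cintegral_dominated (f_ : nat -> R -> R[i]) f (g : R -> R) :
  (forall n, cmeasurable D (f_ n)) ->
  (forall t, D t -> cRe (f_ n t) @[n --> \oo] --> cRe (f t)) ->
  (forall t, D t -> cIm (f_ n t) @[n --> \oo] --> cIm (f t)) ->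
  leb.-integrable D (fun t => (g t)%:E) ->
  (forall n t, D t -> normc (f_ n t) <= g t) ->
  [/\ cintegrable D f,
    cRe (cintegral D (f_ n)) @[n --> \oo] --> cRe (cintegral D f) &
    cIm (cintegral D (f_ n)) @[n --> \oo] --> cIm (cintegral D f)].
Proof.
move=> mf cf1 cf2 ig fg.
have [i1 c1] := Rintegral_dominated (fun n => (mf n).1) cf1 ig
  (fun n t Dt => le_trans (le_Re_normc _) (fg n t Dt)).
have [i2 c2] := Rintegral_dominated (fun n => (mf n).2) cf2 ig
  (fun n t Dt => le_trans (le_Im_normc _) (fg n t Dt)).
by split.
Qed.

End cintegral_theory.

(* [lebesgue_measure] lives on [measurableTypeR R], whose display differs from
   that of the default structure on [R]: hence the type of the pairs below. *)
Section tonelli.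
Context (R : realType) (D1 D2 : set R).
Hypotheses (mD1 : measurable D1) (mD2 : measurable D2).
Local Notation leb := (@lebesgue_measure R).
Local Open Scope ereal_scope.

Lemma integral_exchange_ge0 (f : R -> R -> R) :
  measurable_fun setT (fun p : measurableTypeR R * measurableTypeR R => f p.1 p.2) ->
  (forall t r, D1 t -> D2 r -> (0 <= f t r)%R) ->
  \int[leb]_(t in D1) \int[leb]_(r in D2) (f t r)%:E =
  \int[leb]_(r in D2) \int[leb]_(t in D1) (f t r)%:E.
Proof.
move=> mf f0.
(* Tonelli's theorem integrates over the whole plane, hence the extension by zero. It also makes
   nonnegativity necessary only on [D1 * D2]. *)
pose k : measurableTypeR R * measurableTypeR R -> \bar R :=
  (fun p => (f p.1 p.2)%:E) \_ (D1 `*` D2).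
have kE t r : k (t, r) =
    if (t \in D1) && (r \in D2) then (f t r)%:E else 0.
  by rewrite /k patchE in_setX.
have mX : measurable (D1 `*` D2 : set (measurableTypeR R * measurableTypeR R)).
  exact: measurableX.
have mk : measurable_fun setT k.
  apply: (iffLR (measurable_restrictT _ mX)).
  by apply: measurable_funTS; apply/measurable_EFinP.
have k0 p : 0 <= k p.
  case: p => t r; rewrite kE; case: ifPn => // /andP[tD rD].
  by rewrite lee_fin f0//; exact: set_mem.
rewrite [LHS]integral_mkcond [RHS]integral_mkcond.
have := @fubini_tonelli _ _ _ _ _ leb leb k mk k0.
rewrite /fubini_F /fubini_G => fub.
transitivity (\int[leb]_t \int[leb]_r k (t, r)).
  apply: eq_integral => t _; rewrite patchE; case: ifPn => tD.
    rewrite [LHS]integral_mkcond; apply: eq_integral => r _.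
    by rewrite kE patchE tD.
  by apply/esym; apply: integral0_eq => r _; rewrite kE (negbTE tD).
rewrite fub; apply: eq_integral => r _; rewrite patchE; case: ifPn => rD.
  rewrite [RHS]integral_mkcond; apply: eq_integral => t _.
  by rewrite kE patchE rD andbT.
by apply: integral0_eq => t _; rewrite kE (negbTE rD) andbF.
Qed.

Lemma measurable_integral_ge0 (f : R -> R -> R) :
  measurable_fun setT (fun p : measurableTypeR R * measurableTypeR R => f p.1 p.2) ->
  (forall t r, D2 r -> (0 <= f t r)%R) ->
  measurable_fun D1 (fun t => \int[leb]_(r in D2) (f t r)%:E).
Proof.
move=> mf f0; under eq_fun do rewrite integral_mkcond.
apply: measurable_funTS.
apply: (@measurable_fun_fubini_tonelli_F _ _ _ _ _ leb
  (fun p => ((fun r => (f p.1 r)%:E) \_ D2) p.2)).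
  rewrite (_ : (fun p => _) = (fun p => (f p.1 p.2)%:E) \_
      ([set: measurableTypeR R] `*` D2)).
    apply: (iffLR (measurable_restrictT _ (measurableX measurableT mD2))).
    by apply: measurable_funTS; apply/measurable_EFinP.
  by apply/funext => -[t r]; rewrite !patchE in_setX in_setT.
by move=> p; rewrite patchE; case: ifPn => // rD; rewrite lee_fin f0//; exact: set_mem.
Qed.

End tonelli.

(** * Fubini's theorem for real and complex integrands on a product of two sets *)

Section cfubini.
Context (R : realType) (D1 D2 : set R).
Hypotheses (mD1 : measurable D1) (mD2 : measurable D2).
Local Notation leb := (@lebesgue_measure R).

(** Integrability is asked of every slice, not of almost every one: then each inner integral is a
    finite number, and the iterated real integrals coincide pointwise with [fubini_F] and [fubini_G]
    of the extension by zero. *)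
Lemma Rintegral_exchange (f : R -> R -> R) :
  measurable_fun setT (fun p : measurableTypeR R * measurableTypeR R => f p.1 p.2) ->
  (\int[leb]_(t in D1) \int[leb]_(r in D2) `|f t r|%:E < +oo)%E ->
  (forall r, D2 r -> leb.-integrable D1 (fun t => (f t r)%:E)) ->
  (forall t, D1 t -> leb.-integrable D2 (fun r => (f t r)%:E)) ->
  leb.-integrable D2 (fun r => (\int[leb]_(t in D1) f t r)%:E) /\
  \int[leb]_(r in D2) \int[leb]_(t in D1) f t r =
  \int[leb]_(t in D1) \int[leb]_(r in D2) f t r.
Proof.
move=> mf ff i1 i2.
pose k : measurableTypeR R * measurableTypeR R -> \bar R :=
  (fun p => (f p.1 p.2)%:E) \_ (D1 `*` D2).
have kE t r : k (t, r) =
    if (t \in D1) && (r \in D2) then (f t r)%:E else 0%E.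
  by rewrite /k patchE in_setX.
have mX : measurable (D1 `*` D2 : set (measurableTypeR R * measurableTypeR R)).
  exact: measurableX.
have mk : measurable_fun setT k.
  apply: (iffLR (measurable_restrictT _ mX)).
  by apply: measurable_funTS; apply/measurable_EFinP; assumption.
have ik : (leb \x leb)%E.-integrable setT k.
  apply/integrable12ltyP => //; apply: le_lt_trans ff.
  rewrite [leRHS]integral_mkcond le_eqVlt; apply/orP; left; apply/eqP.
  apply: eq_integral => t _; rewrite patchE; case: ifPn => tD.
    rewrite [RHS]integral_mkcond; apply: eq_integral => r _.
    by rewrite kE patchE tD/=; case: ifPn => // _; rewrite abse0.
  by apply: integral0_eq => r _; rewrite kE (negbTE tD) abse0.
have FE : fubini_F leb k =
    (fun t => (\int[leb]_(r in D2) f t r)%:E) \_ D1.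
  apply/funext => t; rewrite /fubini_F patchE; case: ifPn => tD; last first.
    by apply: integral0_eq => r _; rewrite kE (negbTE tD).
  rewrite /Rintegral fineK; last first.
    by apply: integrable_fin_num => //; apply: i2; exact/set_mem.
  rewrite [RHS]integral_mkcond; apply: eq_integral => r _.
  by rewrite kE patchE tD.
have GE : fubini_G leb k =
    (fun r => (\int[leb]_(t in D1) f t r)%:E) \_ D2.
  apply/funext => r; rewrite /fubini_G patchE; case: ifPn => rD; last first.
    by apply: integral0_eq => t _; rewrite kE (negbTE rD) andbF.
  rewrite /Rintegral fineK; last first.
    by apply: integrable_fin_num => //; apply: i1; exact/set_mem.
  rewrite [RHS]integral_mkcond; apply: eq_integral => t _.
  by rewrite kE patchE rD andbT.
have mak : measurable_fun setT (abse \o k) by exact: measurableT_comp.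
have iG : leb.-integrable setT (fubini_G leb k).
  apply/integrableP; split; first exact: (measurable_fubini_G ik).
  have /(integrable21ltyP _ _ mk) ik' := ik.
  apply: le_lt_trans ik'.
  apply: ge0_le_integral => //.
  - by apply: measurableT_comp => //; exact: (measurable_fubini_G ik).
  - exact: (measurable_fun_fubini_tonelli_G _ mak (fun p => abse_ge0 _)).
  - move=> r _; apply: le_abse_integral => //.
    exact: (measurable_fun_pair1 _ mk).
rewrite GE in iG.
split.
  exact (iffRL (integrable_mkcond (mu := leb)
    (fun r => (\int[leb]_(t in D1) f t r)%:E) mD2) iG).
rewrite {1}/Rintegral [X in _ = X]/Rintegral; congr fine.
rewrite integral_mkcond [RHS]integral_mkcond -FE -GE.
by rewrite (integral21_prod_meas1 ik) (integral12_prod_meas1 ik).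
Qed.

(** Both components are dominated by the modulus, so finiteness of its iterated integral serves for
    the two real exchanges. *)
Lemma cintegral_exchange (H : R -> R -> R[i]) :
  cmeasurable setT (fun p : measurableTypeR R * measurableTypeR R => H p.1 p.2) ->
  (\int[leb]_(t in D1) \int[leb]_(r in D2) (normc (H t r))%:E < +oo)%E ->
  (forall r, D2 r -> cintegrable D1 (H^~ r)) ->
  (forall t, D1 t -> cintegrable D2 (H t)) ->
  cintegrable D2 (fun r => cintegral D1 (H^~ r)) /\
  cintegral D2 (fun r => cintegral D1 (H^~ r)) =
  cintegral D1 (fun t => cintegral D2 (H t)).
Proof.
move=> [mH1 mH2] HH i1 i2.
have dom (f : R -> R -> R) :
    measurable_fun setT
      (fun p : measurableTypeR R * measurableTypeR R => f p.1 p.2) ->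
    (forall t r, `|f t r| <= normc (H t r)) ->
    (\int[leb]_(t in D1) \int[leb]_(r in D2) `|f t r|%:E < +oo)%E.
  move=> mf fH; apply: le_lt_trans HH.
  have mn : measurable_fun setT
      (fun p : measurableTypeR R * measurableTypeR R => (normc (H p.1 p.2))%:E).
    by apply/measurable_EFinP; exact: measurable_normc.
  have ma : measurable_fun setT
      (fun p : measurableTypeR R * measurableTypeR R => `|f p.1 p.2|%:E).
    by apply/measurable_EFinP; exact: measurableT_comp.
  apply: ge0_le_integral => //.
  - by move=> t _; apply: integral_ge0 => r _; rewrite lee_fin.
  - by apply: measurable_integral_ge0 => //; exact: measurableT_comp.
  - apply: measurable_integral_ge0 => //; first exact: measurable_normc.
    by move=> t r _; exact: normc_ge0.
  - move=> t _; apply: ge0_le_integral => //.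
    + by apply: measurable_funTS; exact: (measurable_fun_pair2 _ ma).
    + by apply: measurable_funTS; exact: (measurable_fun_pair2 _ mn).
    + by move=> r _; rewrite lee_fin.
have [j1 e1] := Rintegral_exchange mH1
  (dom _ mH1 (fun t r => le_Re_normc (H t r)))
  (fun r Dr => (i1 r Dr).1) (fun t Dt => (i2 t Dt).1).
have [j2 e2] := Rintegral_exchange mH2
  (dom _ mH2 (fun t r => le_Im_normc (H t r)))
  (fun r Dr => (i1 r Dr).2) (fun t Dt => (i2 t Dt).2).
by split => //; exact: complex_eqP.
Qed.

End cfubini.

(** * Power series and differentiation *)

(** Infinite radius of convergence, expressed by bounded terms at every radius: this form passes to
    the differentiated series simply by enlarging the radius. *)
Definition entire_coef (R : realType) (c : nat -> R) : Prop :=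
  forall r : R, 0 < r -> exists C : R, forall m, `|c m| * r ^+ m <= C.

Lemma entire_coef_cvg (R : realType) (c : nat -> R) (x : R) :
  entire_coef c -> cvgn (pseries c x).
Proof.
move=> ec; have x1 : 0 < `|x| + 1 by rewrite ltr_wpDl.
(* Boundedness at a radius at least twice |x| gives comparison with a geometric series of ratio 1/2;
   the added 1 keeps the radius positive when x = 0. *)
have r0 : 0 < 2 * (`|x| + 1) by rewrite mulr_gt0.
have [C hC] := ec _ r0.
apply: normed_cvg.
apply: (@series_le_cvg _ _ (geometric C (2^-1))) => [m|m|m|] //=.
- apply: mulr_ge0; last by rewrite exprn_ge0// invr_ge0.
  by apply: le_trans (hC 0%N); rewrite expr0 mulr1.
- apply: le_trans (_ : `|c m| * (2 * (`|x| + 1)) ^+ m * 2^-1 ^+ m <= _); last first.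
    by rewrite ler_wpM2r ?exprn_ge0 ?invr_ge0.
  rewrite normrM normrX -mulrA ler_wpM2l// -exprMn lerXn2r ?nnegrE//.
  by rewrite mulrC mulrA mulVf ?mul1r ?lerDl// pnatr_eq0.
- by apply: is_cvg_geometric_series; rewrite ger0_norm ?invr_ge0// invf_lt1// ltr1n.
Qed.

Lemma entire_coef_diffs (R : realType) (c : nat -> R) :
  entire_coef c -> entire_coef (pseries_diffs c).
Proof.
(* Doubling the radius supplies a factor 2^(m+1), which absorbs the m + 1 coming from
   differentiation; the division by [r] below accounts for the shift of index. *)
move=> ec r r0; have r2 : 0 < 2 * r by rewrite mulr_gt0.
have [C hC] := ec _ r2; exists (C / r) => m.
rewrite ler_pdivlMr// -mulrA -exprSr; apply: le_trans (hC m.+1).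
rewrite /pseries_diffs normrM exprMn mulrA; apply: ler_wpM2r.
  by rewrite exprn_ge0// ltW.
rewrite mulrC ler_wpM2l// ger0_norm// -natrX ler_nat.
by apply: ltnW; exact: ltn_expl.
Qed.

Lemma entire_coef_continuous (R : realType) (c : nat -> R) :
  entire_coef c -> continuous (fun x => limn (pseries c x)).
Proof.
(* Termwise differentiation at x uses convergence of the series and of its first two formal
   derivatives at a point beyond |x|, here |x| + 1. *)
move=> ec x; have ed := entire_coef_diffs ec; have edd := entire_coef_diffs ed.
apply: differentiable_continuous; apply/derivable1_diffP.
have [|df _] := @pseries_snd_diffs R c (`|x| + 1) x (entire_coef_cvg ec)
  (entire_coef_cvg ed) (entire_coef_cvg edd) _.
  by rewrite [ltRHS]ger0_norm ?addr_ge0// ltrDl.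
exact: df.
Qed.

Lemma expR_ge_pow (R : realType) (x : R) m : 0 <= x -> x ^+ m <= m`!%:R * expR x.
Proof.
move=> x0; rewrite mulrC -ler_pdivrMr ?ltr0n ?fact_gt0//; case: m => [|m].
  by rewrite expr0 fact0 divr1; apply: le_trans (expR_ge1Dx x); rewrite lerDl.
by apply: le_trans (expR_ge1Dxn m x0); rewrite lerDr.
Qed.

Lemma pow_expR_le (R : realType) (c : R) m : 0 < c ->
  exists C : R, forall x, 0 <= x ->
    x ^+ m * expR (- (c * x)) <= C * expR (- (c / 2 * x)).
Proof.
move=> c0; have c2 : 0 < c / 2 by rewrite divr_gt0.
(* Half of the exponent absorbs the power, by y^m <= m! exp y at y = (c / 2) x; the other half is
   kept. *)
exists (m`!%:R / (c / 2) ^+ m) => x x0.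
have -> : - (c * x) = - (c / 2 * x) - c / 2 * x by lra.
rewrite expRD mulrA ler_wpM2r ?expR_ge0//.
have := expR_ge_pow m (mulr_ge0 (ltW c2) x0).
rewrite exprMn => h; rewrite ler_pdivlMr ?exprn_gt0// expRN mulrAC.
by rewrite ler_pdivrMr ?expR_gt0// mulrC.
Qed.

Lemma integrable_expRN (R : realType) (c : R) : 0 < c ->
  (@lebesgue_measure R).-integrable `]0, +oo[ (fun t => (expR (- (c * t)))%:E).
Proof.
move=> c0.
have h : (@lebesgue_measure R).-integrable `]0, +oo[ (EFin \o exponential_pdf c).
  by apply: integrableS (integrable_exponential_pdf c0).
have h' : (@lebesgue_measure R).-integrable `]0, +oo[
    (fun t => c^-1%:E * (EFin \o exponential_pdf c) t)%E by exact: integrableZl.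
apply: eq_integrable h' => // t; rewrite inE/= in_itv/= andbT => t0.
rewrite exponential_pdfE ?ltW// -EFinM mulrA mulVf ?gt_eqF// mul1r.
by rewrite mulNr.
Qed.

Lemma integrable_cst_expRN (R : realType) (C c : R) : 0 < c ->
  (@lebesgue_measure R).-integrable `]0, +oo[
    (fun t => (C * expR (- (c * t)))%:E).
Proof.
move=> c0; have h : (@lebesgue_measure R).-integrable `]0, +oo[
    (fun t => C%:E * (expR (- (c * t)))%:E)%E.
  by apply: integrableZl => //; exact: integrable_expRN.
by apply: eq_integrable h => // t _; rewrite EFinM.
Qed.

(** * Derivatives of complex-valued functions of a real variable *)

Section cderive.
Context (R : realType).
Implicit Types (f : R -> R[i]) (r : R) (l : R[i]).

Definition cderive f r l : Prop :=
  is_derive r 1 (fun t => cRe (f t)) (cRe l) /\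
  is_derive r 1 (fun t => cIm (f t)) (cIm l).

Lemma cderiveD f g r l l' :
  cderive f r l -> cderive g r l' -> cderive (fun t => f t + g t) r (l + l').
Proof.
move=> [f1 f2] [g1 g2]; split.
  by rewrite ReD; under eq_fun do rewrite ReD; exact: is_deriveD.
by rewrite ImD; under eq_fun do rewrite ImD; exact: is_deriveD.
Qed.

Lemma cderiveZ c f r l : cderive f r l -> cderive (fun t => c * f t) r (c * l).
Proof.
move=> [f1 f2]; split.
  rewrite Re_mul; under eq_fun do rewrite Re_mul.
  by apply: is_deriveB; exact: is_deriveZ.
rewrite Im_mul; under eq_fun do rewrite Im_mul.
by apply: is_deriveD; exact: is_deriveZ.
Qed.

Lemma cderive_mulid f r l : cderive f r l ->
  cderive (fun t => f t * t%:C) r (l * r%:C + f r).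
Proof.
move=> [f1 f2]; split.
  rewrite ReD Re_mul/=; under eq_fun do rewrite Re_mul/=.
  under eq_fun do rewrite mulr0 subr0.
  apply: (is_derive_eq (is_deriveM f1 (is_derive_id r 1))).
  by rewrite /= mulr0 subr0 addrC /GRing.scale/= mulr1 mulrC.
rewrite ImD Im_mul/=; under eq_fun do rewrite Im_mul/=.
under eq_fun do rewrite mulr0 add0r.
apply: (is_derive_eq (is_deriveM f2 (is_derive_id r 1))).
by rewrite /= mulr0 add0r addrC /GRing.scale/= mulr1 mulrC.
Qed.

Lemma cderive_cexp (z : R[i]) r :
  cderive (fun t => cexp (z * t%:C)) r (z * cexp (z * r%:C)).
Proof.
have Rez t : cRe (z * t%:C) = cRe z * t by rewrite Re_mul/= mulr0 subr0.
have Imz t : cIm (z * t%:C) = cIm z * t by rewrite Im_mul/= mulr0 add0r.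
split.
  under eq_fun do rewrite Re_cexp Rez Imz.
  apply: is_derive_eq; rewrite Re_mul Re_cexp Im_cexp Rez Imz.
  by rewrite /GRing.scale/=; ring.
under eq_fun do rewrite Im_cexp Rez Imz.
apply: is_derive_eq; rewrite Im_mul Re_cexp Im_cexp Rez Imz.
by rewrite /GRing.scale/=; ring.
Qed.

End cderive.

(** * The fundamental theorem of calculus on the half-line *)

Section FTC_infinity.
Context (R : realType).
Local Notation leb := (@lebesgue_measure R).

Lemma is_derive_continuous (f : R -> R) (r l : R) :
  is_derive r (1 : R) f l -> {for r, continuous f}.
Proof. by move=> [df _]; apply: differentiable_continuous; exact/derivable1_diffP. Qed.

(** Decay of [F] along the integers is enough because [f] is integrable: the truncations of [f] are
    dominated by |f|, so the integrals over bounded intervals tend to the one over the half-line. *)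
Lemma Rintegral_FTC2y (F f : R -> R) :
  (forall r : R, is_derive r (1 : R) F (f r)) -> continuous f ->
  leb.-integrable `]0, +oo[ (fun r => (f r)%:E) ->
  F n%:R @[n --> \oo] --> 0 ->
  \int[leb]_(r in `]0, +oo[) f r = - F 0.
Proof.
move=> dF cf fi F0.
have cF : continuous F by move=> r; exact: is_derive_continuous (dF r).
(* The shift to n + 1 keeps the interval nondegenerate for every n. *)
have FTC n : \int[leb]_(r in `]0, n.+1%:R]) f r = F n.+1%:R - F 0.
  have n0 : (0 : R) < n.+1%:R by rewrite ltr0n.
  rewrite /Rintegral integral_itv_obnd_cbnd; last first.
    apply/measurable_EFinP/measurable_funTS.
    exact: continuous_measurable_fun.
  rewrite (@continuous_FTC2 _ f F)//.
  - exact: continuous_subspaceT.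
  - split; first by move=> r _; have [] := dF r.
      by apply: cvg_at_right_filter; exact: cF.
    by apply: cvg_at_left_filter; exact: cF.
  - by move=> r _; rewrite derive1E; have [_ ->] := dF r.
pose D : set R := `]0, +oo[.
have mD : measurable D by exact: measurable_itv.
have mf : measurable_fun D f by apply: measurable_funTS; exact: continuous_measurable_fun.
have [] := @Rintegral_dominated _ D mD
    (fun n => f \_ `]-oo, (n.+1%:R : R)]) f (fun r => `|f r|).
- move=> n; apply: (measurable_funS measurableT) => //.
  apply: (iffLR (measurable_restrictT _ (measurable_itv _))).
  by apply: measurable_funTS; exact: continuous_measurable_fun.
- move=> r _; apply: cvg_near_cst; near=> n.
  rewrite patchE ifT// inE/= in_itv/=.
  apply: le_trans (_ : n%:R <= _); last by rewrite ler_nat.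
  by near: n; exact: nbhs_infty_ger.
- exact: integrable_abse fi.
- move=> n r _; rewrite patchE; case: ifPn => // _.
  by rewrite normr0.
move=> _ H.
apply/esym/(cvg_unique _ _ H) => //.
have -> : (fun n : nat => \int[leb]_(r in D) (f \_ `]-oo, (n.+1%:R : R)]) r) =
    (fun n => F n.+1%:R - F 0).
  apply/funext => n; rewrite -FTC -Rintegral_mkcondr; congr Rintegral.
  apply/seteqP; split => r; rewrite /D /= !in_itv/= andbT.
    by move=> [-> ->].
  by move=> /andP[-> ->].
rewrite /= -[X in _ --> X]sub0r; apply: cvgB; last exact: cvg_cst.
have := F0; rewrite -(cvg_shiftS (fun n => F n%:R)); exact.
Unshelve. all: by end_near. Qed.
End FTC_infinity.

(** * Laplace transform of a power series *)

Section laplace_monomial.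
Context (R : realType).
Local Notation leb := (@lebesgue_measure R).

Lemma cderive_cmeasurable (f f' : R -> R[i]) (D : set R) :
  (forall r, cderive f r (f' r)) -> cmeasurable D f.
Proof.
move=> df; split; apply: measurable_funTS; apply: continuous_measurable_fun => r.
  exact: is_derive_continuous (df r).1.
exact: is_derive_continuous (df r).2.
Qed.

(** The derivative [f'] is there to supply continuity of [f]; decay of the modulus of [F] squeezes
    both components to 0. *)
Lemma cintegral_FTC2y (F f f' : R -> R[i]) :
  (forall r, cderive F r (f r)) -> (forall r, cderive f r (f' r)) ->
  cintegrable `]0, +oo[ f -> normc (F n%:R) @[n --> \oo] --> 0 ->
  cintegral `]0, +oo[ f = - F 0.
Proof.
move=> dF df [f1 f2] F0.
have sq (h : nat -> R) : (forall n, `|h n| <= normc (F n%:R)) ->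
    h n @[n --> \oo] --> 0.
  move=> hF; apply/norm_cvg0P; apply: (squeeze_cvgr _ (cvg_cst 0) F0).
  by apply: nearW => n; rewrite normr_ge0 hF.
apply: complex_eqP; rewrite ?ReN ?ImN /=.
  apply: (Rintegral_FTC2y (F := fun r => cRe (F r))) => //.
  - by move=> r; exact: (dF r).1.
  - by move=> r; exact: is_derive_continuous (df r).1.
  - by apply: sq => n; exact: le_Re_normc.
apply: (Rintegral_FTC2y (F := fun r => cIm (F r))) => //.
- by move=> r; exact: (dF r).2.
- by move=> r; exact: is_derive_continuous (df r).2.
- by apply: sq => n; exact: le_Im_normc.
Qed.

Variables (s : R[i]) (s0 : 0 < cRe s).

Let A m (r : R) : R[i] := cexp (- s * r%:C) * r%:C ^+ m.

Let AS m r : A m.+1 r = A m r * r%:C.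
Proof. by rewrite /A exprSr mulrA. Qed.

(** At m = 0 the predecessor is again 0, but the factor [m%:R] vanishes. This lets the single
    formula [dA] give the derivative of [A m] for all m. *)
Let mulA m (r : R) : m%:R * A m.-1 r * r%:C = m%:R * A m r.
Proof. by case: m => [|m]; rewrite ?mul0r// -mulrA -AS. Qed.

Let dA m (r : R) : R[i] := - s * A m r + m%:R * A m.-1 r.

Let cderiveA m r : cderive (A m) r (dA m r).
Proof.
elim: m r => [|m IH] r.
  have -> : A 0 = (fun t => cexp (- s * t%:C)).
    by apply/funext => t; rewrite /A expr0 mulr1.
  rewrite /dA mul0r addr0 /A expr0 mulr1; exact: cderive_cexp.
have -> : A m.+1 = (fun t => A m t * t%:C) by apply/funext => t; exact: AS.
have -> : dA m.+1 r = dA m r * r%:C + A m r.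
  by rewrite /dA AS [in RHS]mulrDl mulA /= -natr1; ring.
exact: cderive_mulid.
Qed.

Let cderive_dA m r : cderive (dA m) r (- s * dA m r + m%:R * dA m.-1 r).
Proof. by apply: cderiveD; apply: cderiveZ; exact: cderiveA. Qed.

Lemma normc_cexp_real (r : R) : normc (cexp (- s * r%:C)) = expR (- (cRe s * r)).
Proof. by rewrite normc_cexp Re_mul/= mulr0 subr0 ReN mulNr. Qed.

Let normcA m (r : R) : 0 <= r -> normc (A m r) = r ^+ m * expR (- (cRe s * r)).
Proof.
move=> r0; rewrite ComplexField.Normc.normcM normc_cexp_real normcX normc_real.
by rewrite ger0_norm// mulrC.
Qed.

Let cintegrableA m : cintegrable `]0, +oo[ (A m).
Proof.
have [C hC] := pow_expR_le m s0.
apply: (cintegrable_dom (measurable_itv _)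
  (g := fun t => C * expR (- (cRe s / 2 * t)))).
- by apply: cderive_cmeasurable => r; exact: cderiveA.
- by apply: integrable_cst_expRN; rewrite divr_gt0.
- move=> t; rewrite /= in_itv/= andbT => t0.
  by rewrite normcA ?(ltW t0)//; exact: hC (ltW t0).
Qed.

Let cvgA m : normc (A m n%:R) @[n --> \oo] --> 0.
Proof.
have [C hC] := pow_expR_le m s0.
have c0 : 0 < cRe s / 2 by rewrite divr_gt0.
have h : C * expR (- (cRe s / 2)) ^+ n @[n --> \oo] --> 0.
  apply: cvg_geometric; rewrite ger0_norm ?expR_ge0//.
  by rewrite expR_lt1 oppr_lt0.
apply: (squeeze_cvgr _ (cvg_cst 0) h); apply: nearW => n.
rewrite normc_ge0/= normcA// -expRM_natl mulrN mulrC [n%:R * _]mulrC.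
by rewrite mulrC hC.
Qed.

Lemma laplace_monomial m :
  cintegrable `]0, +oo[ (fun r => cexp (- s * r%:C) * r%:C ^+ m) /\
  cintegral `]0, +oo[ (fun r => cexp (- s * r%:C) * r%:C ^+ m) =
  m`!%:R / s ^+ m.+1.
Proof.
split; first exact: cintegrableA.
have mD : measurable (`]0, +oo[ : set R) by exact: measurable_itv.
have sN0 : s != 0.
  by apply/eqP => sE; move: s0; rewrite sE/= ltxx.
(* Integration by parts: the integral of [dA k] over the half-line is [- A k 0]. The boundary term
   is 1 for k = 0 and 0 otherwise, so the recursion yields m! / s^(m+1) directly for complex [s]. *)
have rec k : s * cintegral `]0, +oo[ (A k) =
    k%:R * cintegral `]0, +oo[ (A k.-1) + A k 0.
  have h1 : cintegrable `]0, +oo[ (fun r => - s * A k r).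
    by apply: cintegrableZ.
  have h2 : cintegrable `]0, +oo[ (fun r => k%:R * A k.-1 r).
    by apply: cintegrableZ.
  have := cintegral_FTC2y (cderiveA k) (cderive_dA k)
    (cintegrableD mD h1 h2) (cvgA k).
  rewrite /dA cintegralD// !cintegralZ// => h.
  by rewrite -[A k 0]opprK -h; ring.
rewrite -/(A m); elim: m => [|m IH].
  apply: (mulfI sN0); rewrite rec mul0r add0r /A expr0 mulr1 mulr0.
  rewrite fact0 expr1 div1r divff//; apply: complex_eqP.
    by rewrite Re_cexp/= expR0 cos0 mulr1.
  by rewrite Im_cexp/= sin0 mulr0.
apply: (mulfI sN0); rewrite rec IH AS mulr0 addr0 factS natrM [in RHS]exprS.
by field; rewrite expf_neq0 sN0.
Qed.

End laplace_monomial.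

(* [\sum_m a_m m! z^m], the termwise Laplace transform, is entire. *)
Definition laplace_coef (R : realType) (a : nat -> R[i]) : Prop :=
  forall r : R, 0 < r -> exists C : R, forall m, normc (a m) * m`!%:R * r ^+ m <= C.

Definition powser_sum (R : realType) (a : nat -> R[i]) (z : R[i]) (n : nat) : R[i] :=
  \sum_(0 <= k < n) a k * z ^+ k.

(* The sum of the series at the real point [- v], split into two real power
   series so that the theory of [pseries] applies. *)
Definition powser_neg (R : realType) (a : nat -> R[i]) (v : R) : R[i] :=
  limn (pseries (fun k => cRe (a k)) (- v)) +i*
  limn (pseries (fun k => cIm (a k)) (- v)).

Lemma sum_exp_coeff_le (R : realType) (x : R) n : 0 <= x ->
  \sum_(0 <= k < n) x ^+ k / k`!%:R <= expR x.
Proof.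
move=> x0; apply: (nondecreasing_cvgn_le _ (is_cvg_series_exp_coeff x)).
apply/nondecreasing_seqP => k; rewrite /series/= big_nat_recr//= lerDl.
by rewrite divr_ge0 ?exprn_ge0.
Qed.

(** * Growth and Laplace transform of the sum on the negative half-axis *)

Section powser.
Context (R : realType) (a : nat -> R[i]) (La : laplace_coef a).

Lemma laplace_coef_entire :
  entire_coef (fun k => cRe (a k)) /\ entire_coef (fun k => cIm (a k)).
Proof.
have aux (c : nat -> R) : (forall k, `|c k| <= normc (a k)) -> entire_coef c.
  move=> ca r r0; have [C hC] := La r0; exists C => m; apply: le_trans (hC m).
  rewrite ler_wpM2r ?exprn_ge0 ?(ltW r0)//; apply: le_trans (ca m) _.
  by rewrite ler_peMr ?normc_ge0// ler1n fact_gt0.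
by split; apply: aux => k; [exact: le_Re_normc|exact: le_Im_normc].
Qed.

Lemma Re_powser_sum (x : R) n :
  cRe (powser_sum a x%:C n) = pseries (fun k => cRe (a k)) x n.
Proof.
rewrite /powser_sum Re_sum /pseries /series/=; apply: eq_bigr => k _.
by rewrite -rmorphXn Re_mul/= mulr0 subr0.
Qed.

Lemma Im_powser_sum (x : R) n :
  cIm (powser_sum a x%:C n) = pseries (fun k => cIm (a k)) x n.
Proof.
rewrite /powser_sum Im_sum /pseries /series/=; apply: eq_bigr => k _.
by rewrite -rmorphXn Im_mul/= mulr0 add0r.
Qed.

Lemma cvg_Re_powser_neg (v : R) :
  cRe (powser_sum a (- v)%:C n) @[n --> \oo] --> cRe (powser_neg a v).
Proof.
under eq_fun do rewrite Re_powser_sum.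
exact: entire_coef_cvg laplace_coef_entire.1.
Qed.

Lemma cvg_Im_powser_neg (v : R) :
  cIm (powser_sum a (- v)%:C n) @[n --> \oo] --> cIm (powser_neg a v).
Proof.
under eq_fun do rewrite Im_powser_sum.
exact: entire_coef_cvg laplace_coef_entire.2.
Qed.

Lemma continuous_Re_powser_neg : continuous (fun v => cRe (powser_neg a v)).
Proof.
move=> v; apply: (@continuous_comp _ _ _ -%R
  (fun x => limn (pseries (fun k => cRe (a k)) x))).
  exact: opp_continuous.
exact: entire_coef_continuous laplace_coef_entire.1 _.
Qed.

Lemma continuous_Im_powser_neg : continuous (fun v => cIm (powser_neg a v)).
Proof.
move=> v; apply: (@continuous_comp _ _ _ -%R
  (fun x => limn (pseries (fun k => cIm (a k)) x))).
  exact: opp_continuous.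
exact: entire_coef_continuous laplace_coef_entire.2 _.
Qed.

Lemma continuous_normc_powser_neg :
  continuous (fun v => normc (powser_neg a v)).
Proof.
under eq_fun do rewrite normc_sqrt.
have sq (h : R -> R) : continuous h -> continuous (fun v => h v ^+ 2).
  by move=> ch v; under eq_fun do rewrite expr2; apply: cvgM; exact: ch.
move=> v; apply: continuous_comp; last exact: sqrt_continuous.
by apply: cvgD; [exact: (sq _ continuous_Re_powser_neg)|
  exact: (sq _ continuous_Im_powser_neg)].
Qed.

Lemma cmeasurable_powser_neg d (T : measurableType d) (D : set T) (h : T -> R) :
  measurable_fun D h -> cmeasurable D (fun t => powser_neg a (h t)).
Proof.
move=> mh; split.
  apply: (measurableT_comp (f := fun v => cRe (powser_neg a v))) => //.
  by apply: continuous_measurable_fun; exact: continuous_Re_powser_neg.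
apply: (measurableT_comp (f := fun v => cIm (powser_neg a v))) => //.
by apply: continuous_measurable_fun; exact: continuous_Im_powser_neg.
Qed.

(** [laplace_coef] at radius 1 / c reads |a_k| <= C c^k / k!, and the partial sums are then compared
    with those of C exp (c v). The bound is uniform in n, hence usable for dominated convergence. *)
Lemma normc_powser_sum_le (c : R) : 0 < c -> exists C : R, forall v n, 0 <= v ->
  normc (powser_sum a (- v)%:C n) <= C * expR (c * v).
Proof.
move=> c0; have r0 : 0 < c^-1 by rewrite invr_gt0.
have [C hC] := La r0; exists C => v n v0.
have C0 : 0 <= C.
  apply: le_trans (hC 0%N).
  by rewrite fact0 expr0 !mulr1 normc_ge0.
apply: le_trans (normc_sum_le _ _) _.
apply: le_trans (_ : C * \sum_(0 <= k < n) (c * v) ^+ k / k`!%:R <= _); last first.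
  by rewrite ler_wpM2l// sum_exp_coeff_le// mulr_ge0// ltW.
rewrite mulr_sumr; apply: ler_sum => k _.
rewrite ComplexField.Normc.normcM normcX normc_real normrN ger0_norm//.
have f0 : (0 : R) < k`!%:R by rewrite ltr0n fact_gt0.
have ck : 0 < c ^+ k by rewrite exprn_gt0.
have := hC k; rewrite exprVn ler_pdivrMr// -ler_pdivlMr// => h.
rewrite exprMn [leRHS](_ : _ = C * c ^+ k / k`!%:R * v ^+ k).
  by rewrite ler_wpM2r// exprn_ge0.
by field; rewrite gt_eqF.
Qed.

Context (s : R[i]) (s0 : 0 < cRe s) (u : R) (u0 : 0 < u).

Let fn n (r : R) : R[i] := cexp (- s * r%:C) * powser_sum a (- (r / u))%:C n.

Let b m : R[i] := a m * m`!%:R.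

Let fnS n : fn n.+1 = (fun r => fn n r +
  a n * (- u^-1)%:C ^+ n * (cexp (- s * r%:C) * r%:C ^+ n)).
Proof.
apply/funext => r; rewrite /fn /powser_sum big_nat_recr//= mulrDr; congr (_ + _).
have -> : - (r / u) = - u^-1 * r by rewrite mulNr mulrC.
rewrite [X in X ^+ n]rmorphM exprMn.
by move: (cexp _) (a n) ((- u^-1)%:C ^+ n) (r%:C ^+ n) => z1 z2 z3 z4; ring.
Qed.

(** A monomial contributes m! / s^(m+1); the prefactor [s] removes the surplus power, leaving a_m m!
    times the m-th power of - 1 / (s u). *)
Let cintegral_fn n : cintegrable `]0, +oo[ (fn n) /\
  s * cintegral `]0, +oo[ (fn n) = powser_sum b (- (1 / s) / u%:C) n.
Proof.
have mD : measurable (`]0, +oo[ : set R) by exact: measurable_itv.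
have sN0 : s != 0.
  by apply/eqP => sE; move: s0; rewrite sE/= ltxx.
elim: n => [|n [IH1 IH2]].
  (* The empty sum is written as a multiple of a monomial so that its integrability comes from
     [laplace_monomial]. *)
  have -> : fn 0 = (fun r => 0 * (cexp (- s * r%:C) * r%:C ^+ 0)).
    by apply/funext => r; rewrite /fn /powser_sum big_nil mulr0 mul0r.
  have [i0 _] := laplace_monomial s0 0.
  split; first exact: cintegrableZ.
  by rewrite cintegralZ// mul0r mulr0 /powser_sum big_nil.
have [iA eA] := laplace_monomial s0 n.
have iZ : cintegrable `]0, +oo[
    (fun r => a n * (- u^-1)%:C ^+ n * (cexp (- s * r%:C) * r%:C ^+ n)).
  exact: cintegrableZ.
rewrite fnS; split; first exact: cintegrableD.
rewrite cintegralD// mulrDr IH2 cintegralZ// eA /powser_sum big_nat_recr//=.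
congr (_ + _); rewrite /b.
have -> : (- u^-1)%:C = - (u%:C)^-1 by rewrite rmorphN fmorphV.
have -> : - (1 / s) / u%:C = - (u%:C)^-1 * s^-1 by rewrite div1r !mulNr mulrC.
rewrite exprMn exprVn exprS; move: ((- (u%:C)^-1) ^+ n) => z.
by field; rewrite expf_neq0 sN0.
Qed.

(** The value of the integral is given as the limit of partial sums, to be matched by uniqueness of
    limits with the right-hand [Mseries]. *)
Lemma laplace_powser_neg :
  [/\ cintegrable `]0, +oo[
        (fun r => cexp (- s * r%:C) * powser_neg a (r / u)),
    cRe (powser_sum (fun m => a m * m`!%:R) (- (1 / s) / u%:C) n) @[n --> \oo] -->
      cRe (s * cintegral `]0, +oo[
        (fun r => cexp (- s * r%:C) * powser_neg a (r / u))) &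
    cIm (powser_sum (fun m => a m * m`!%:R) (- (1 / s) / u%:C) n) @[n --> \oo] -->
      cIm (s * cintegral `]0, +oo[
        (fun r => cexp (- s * r%:C) * powser_neg a (r / u)))].
Proof.
have mD : measurable (`]0, +oo[ : set R) by exact: measurable_itv.
(* With this rate the growth in r / u is exp (Re s r / 2), which uses up half of the decay of exp (-
   s r). The constant obtained depends on [u]. *)
have su0 : 0 < cRe s / 2 * u by rewrite mulr_gt0// divr_gt0.
have [C hC] := normc_powser_sum_le su0.
have lim_mul (w : R[i]) (z_ : nat -> R[i]) (z : R[i]) :
    cRe (z_ n) @[n --> \oo] --> cRe z -> cIm (z_ n) @[n --> \oo] --> cIm z ->
    cRe (w * z_ n) @[n --> \oo] --> cRe (w * z) /\
    cIm (w * z_ n) @[n --> \oo] --> cIm (w * z).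
  move=> h1 h2; split.
    rewrite Re_mul; under eq_fun do rewrite Re_mul.
    by apply: cvgB; apply: cvgM => //; exact: cvg_cst.
  rewrite Im_mul; under eq_fun do rewrite Im_mul.
  by apply: cvgD; apply: cvgM => //; exact: cvg_cst.
have lf r := lim_mul (cexp (- s * r%:C)) _ _
  (@cvg_Re_powser_neg (r / u)) (@cvg_Im_powser_neg (r / u)).
have [] := @cintegral_dominated _ _ mD fn
  (fun r => cexp (- s * r%:C) * powser_neg a (r / u))
  (fun r => C * expR (- (cRe s / 2 * r))).
- by move=> n; exact: cintegrable_cmeasurable (cintegral_fn n).1.
- by move=> r _; exact: (lf r).1.
- by move=> r _; exact: (lf r).2.
- by apply: integrable_cst_expRN; rewrite divr_gt0.
- move=> n r; rewrite /= in_itv/= andbT => r0.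
  rewrite /fn ComplexField.Normc.normcM normc_cexp_real.
  apply: le_trans (ler_wpM2l (expR_ge0 _) (hC (r / u) n _)) _.
    by rewrite divr_ge0// ltW.
  rewrite mulrCA -expRD [_ * u * _](_ : _ = cRe s / 2 * r); last first.
    by field; rewrite gt_eqF.
  rewrite (_ : - (cRe s * r) + cRe s / 2 * r = - (cRe s / 2 * r))//.
  by field.
move=> fi c1 c2; split => //.
- under eq_fun do rewrite -(cintegral_fn _).2.
  exact: (lim_mul s _ _ c1 c2).1.
- under eq_fun do rewrite -(cintegral_fn _).2.
  exact: (lim_mul s _ _ c1 c2).2.
Qed.

End powser.

(** * Integrability of the double integral *)

Lemma continuous_measurable_EFin (R : realType) (f : R -> R) (D : set R) :
  continuous f -> measurable_fun D (fun t => (f t)%:E).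
Proof.
move=> cf; apply/measurable_EFinP; apply: measurable_funTS.
exact: continuous_measurable_fun.
Qed.

Section kernel_bound.
Context (R : realType).
Local Notation leb := (@lebesgue_measure R).

Lemma power_expRN_bound (a c : R) : 0 < a -> 0 < c ->
  exists2 C : R, 0 <= C &
    forall x, 0 < x -> expR (a * ln x) * expR (- (c * x)) <= C.
Proof.
(* With y = c x / a, the exponent a ln x - c x equals a (ln y - y) + a ln (a / c), and ln y < y. *)
move=> a0 c0; exists (expR (a * ln (a / c))); first exact: expR_ge0.
move=> x x0; rewrite -expRD ler_expR.
have ac : 0 < a / c by rewrite divr_gt0.
have y0 : 0 < c * x / a by rewrite divr_gt0// mulr_gt0.
have -> : x = c * x / a * (a / c) by field; rewrite !gt_eqF.
rewrite lnM ?posrE// mulrDr.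
have := ltW (ln_sublinear y0); rewrite -(ler_pM2l a0) => h.
have e : c * (c * x / a * (a / c)) = a * (c * x / a).
  by field; rewrite !gt_eqF.
by rewrite e; lra.
Qed.

Lemma continuous_expR_affine (k c : R) : continuous (fun t : R => expR (k * t + c)).
Proof.
move=> t; apply: continuous_comp; last exact: continuous_expR.
apply: cvgD; last exact: cvg_cst.
by apply: cvgM; [exact: cvg_cst|exact: cvg_id].
Qed.

Lemma integral_expR_affine (k c : R) : k != 0 ->
  (\int[leb]_(t in `]0%R, 1%R[) (expR (k * t + c))%:E =
  ((expR (k + c) - expR c) / k)%:E)%E.
Proof.
move=> k0.
have dF (t : R) : is_derive t (1 : R)
    (fun t : R => k^-1 * expR (k * t + c)) (expR (k * t + c)).
  apply: is_derive_eq; rewrite /GRing.scale/=.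
  by field.
rewrite -(integral_itv_bndoo true false); last first.
  by apply: continuous_measurable_EFin; exact: continuous_expR_affine.
rewrite (@continuous_FTC2 _ _ (fun t : R => k^-1 * expR (k * t + c)))//.
- by rewrite mulr1 mulr0 add0r -EFinB -mulrBr mulrC.
- by apply: continuous_subspaceT; exact: continuous_expR_affine.
- split; first by move=> r _; have [] := dF r.
    by apply: cvg_at_right_filter; exact: is_derive_continuous (dF 0).
  by apply: cvg_at_left_filter; exact: is_derive_continuous (dF 1).
- by move=> r _; rewrite derive1E; have [_ ->] := dF r.
Qed.

(** Applied with k proportional to v, this gains the factor 1 / v that turns the exponent - a into -
    (a + 1) in the bound on the kernel. *)
Lemma integral_expR_left (k : R) : 0 < k ->
  (\int[leb]_(t in `]0%R, 1%R[) (expR (- (k * t)))%:E <= (k^-1)%:E)%E.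
Proof.
move=> k0; under eq_integral do rewrite -mulNr -[(_ * _)%R]addr0.
rewrite integral_expR_affine ?oppr_eq0 ?gt_eqF// lee_fin addr0 expR0 invrN mulrN.
by rewrite -mulNr opprB ler_pdivrMr// mulVf ?gt_eqF// gerBl expR_ge0.
Qed.

Lemma integral_expR_right (k : R) : 0 < k ->
  (\int[leb]_(t in `]0%R, 1%R[) (expR (- (k * (1 - t))))%:E <= (k^-1)%:E)%E.
Proof.
move=> k0; under eq_integral => t _.
  rewrite (_ : - (k * (1 - t)) = k * t + - k)%R; last by ring.
  over.
rewrite integral_expR_affine ?gt_eqF// lee_fin subrr expR0.
by rewrite ler_pdivrMr// mulVf ?gt_eqF// gerBl expR_ge0.
Qed.

End kernel_bound.

(** On (0, 1) this is t^(a-1) (1-t)^(b-1), written as the modulus of the [cpow] factors comes out,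
    with a = Re x and b = Re y. The default value of [ln] keeps it total and nonnegative. *)
Definition beta_weight (R : realType) (a b t : R) : R :=
  expR ((a - 1) * ln t) * expR ((b - 1) * ln (1 - t)).

Lemma beta_weight_ge0 (R : realType) (a b t : R) : 0 <= beta_weight a b t.
Proof. by rewrite mulr_ge0// expR_ge0. Qed.

Lemma measurable_beta_weight (R : realType) (a b : R) (D : set R) :
  measurable_fun D (beta_weight a b).
Proof.
have mexp c (h : R -> R) : measurable_fun D h ->
    measurable_fun D (fun t => expR (c * ln (h t))).
  move=> mh; apply: (measurableT_comp (@measurable_expR R)).
  apply: measurable_funM => //.
  exact: (measurableT_comp (@measurable_ln R)).
apply: measurable_funM; apply: mexp => //.
by apply: measurable_funB.
Qed.

(** * The substitution v = 1 / (t (1 - t)) on the two halves of (0, 1) *)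

Section tent_substitution.
Context (R : realType).
Local Notation leb := (@lebesgue_measure R).

Let F (t : R) : R := (t * (1 - t))^-1.
Let dF (t : R) : R := - ((1 - 2 * t) * (F t) ^+ 2).

Let tent_gt0 (t : R) : 0 < t < 1 -> 0 < t * (1 - t).
Proof. by move=> /andP[t0 t1]; rewrite mulr_gt0// subr_gt0. Qed.

Let is_derive_F (t : R) : 0 < t < 1 -> is_derive t (1 : R) F (dF t).
Proof.
move=> t01; have t0 := tent_gt0 t01.
apply: is_derive_eq; first by apply: is_deriveV; rewrite gt_eqF.
rewrite /GRing.scale/= /dF /F exprVn; ring.
Qed.

Let continuous_F (t : R) : 0 < t < 1 -> {for t, continuous F}.
Proof. by move=> t01; exact: is_derive_continuous (is_derive_F t01). Qed.

Let deriveF (t : R) : 0 < t < 1 -> F^`() t = dF t.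
Proof. by move=> t01; rewrite derive1E; have [_ ->] := is_derive_F t01. Qed.

Let continuous_dF (t : R) : 0 < t < 1 -> {for t, continuous F^`()}.
Proof.
move=> t01; rewrite /prop_for /continuous_at deriveF//.
have cdF : {for t, continuous dF}.
  apply: cvgN; apply: cvgM; last first.
    by under eq_fun do rewrite expr2; apply: cvgM; exact: continuous_F.
  apply: cvgB; first exact: cvg_cst.
  by apply: cvgM; [exact: cvg_cst|exact: cvg_id].
apply: cvg_trans cdF; apply: near_eq_cvg.
have tin : t \in `]0, 1[%R by rewrite in_itv.
apply: filterS (near_in_itvoo tin) => z; rewrite in_itv/= => z01.
by rewrite deriveF.
Qed.

(** The product is y (1 - y) - x (1 - x), so one criterion covers the decreasing half, where x + y <
    1, and the increasing half, where x + y > 1. *)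
Let F_lt (x y : R) : 0 < x < 1 -> 0 < y < 1 -> 0 < (y - x) * (1 - x - y) ->
  F y < F x.
Proof.
move=> x01 y01 xy; rewrite /F ltf_pV2 ?posrE ?tent_gt0//.
by rewrite -subr_gt0 [ltRHS](_ : _ = (y - x) * (1 - x - y))//; ring.
Qed.

Variables (phi : R -> R) (cphi : continuous phi) (phi0 : forall v, 0 <= phi v).

Let G (c v : R) : R := phi v * expR (- (c + 1) * ln v).

Let continuous_G c (v : R) : 0 < v -> {for v, continuous (G c)}.
Proof.
move=> v0; apply: cvgM; first exact: cphi.
apply: continuous_comp; last exact: continuous_expR.
by apply: cvgM; [exact: cvg_cst|exact: continuous_ln].
Qed.

Let within_G c (x y : R) : 0 < x -> {within `[x, y], continuous (G c)}.
Proof.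
move=> x0; apply: continuous_in_subspaceT => v; rewrite inE/= in_itv/=.
by move=> /andP[xv _]; apply: continuous_G; exact: lt_le_trans xv.
Qed.

(** The exponents combine as - (c + 1) + 2 = 1 - c, and F^(1-c) = (t (1 - t))^(c-1): with the factor
    F^2 of the derivative, the tail weight becomes the beta weight with both parameters [c]. *)
Let G_F c (t : R) : 0 < t < 1 ->
  G c (F t) * (F t) ^+ 2 =
  phi (F t) * (expR ((c - 1) * ln t) * expR ((c - 1) * ln (1 - t))).
Proof.
move=> t01; have u0 := tent_gt0 t01; have /andP[t0 t1] := t01.
have F0 : 0 < F t by rewrite invr_gt0.
rewrite /G -mulrA; congr (_ * _).
rewrite -[in X in _ * X](lnK F0) -expRM_natl -!expRD; congr expR.
by rewrite /F lnV ?posrE// lnM ?posrE ?subr_gt0//; ring.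
Qed.

(** Here |ln s| <= ln 2, so changing the exponent costs at most 2^|a-b|. It serves at the endpoint
    that the chosen half of (0, 1) stays away from, where the symmetric weight has the wrong
    exponent. *)
Let ln2B (a b s : R) : 2^-1 <= s <= 1 ->
  expR ((a - 1) * ln s) <= expR (`|a - b| * ln 2) * expR ((b - 1) * ln s).
Proof.
move=> /andP[s2 s1]; rewrite -expRD ler_expR.
have s0 : 0 < s by apply: lt_le_trans s2; rewrite invr_gt0.
have l1 : - ln 2 <= ln s by rewrite -lnV ?posrE// ler_ln ?posrE// invr_gt0.
have l2 : ln s <= 0 by rewrite ln_le0.
have : (a - b) * ln s <= `|a - b| * ln 2.
  apply: le_trans (ler_norm _) _; rewrite normrM ler_wpM2l//.
  by rewrite ler0_norm// lerNl.
lra.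
Qed.

Let mF D : measurable_fun D F.
Proof.
apply: (measurableT_comp (@measurable_invr R)).
by apply: measurable_funM => //; exact: measurable_funB.
Qed.

Let mphiF D : measurable_fun D (fun t => phi (F t)).
Proof. by apply: (measurableT_comp (continuous_measurable_fun cphi)); exact: mF. Qed.

Let I a b : \bar R := (\int[leb]_(t in `]0%R, 1%R[) (beta_weight a b t * phi (F t))%:E)%E.

(** The estimate common to both halves; [k] is what remains of the Jacobian once F^2 is absorbed,
    namely 1 - 2 t or 2 t - 1. *)
Let sub_bound a b c (D : set R) (k : R -> R) (C : R) :
  measurable D -> D `<=` `]0, 1[ -> measurable_fun D k -> 0 <= C ->
  (forall t, D t -> 0 <= k t <= 1) ->
  (forall t, D t -> beta_weight c c t <= C * beta_weight a b t) ->
  (\int[leb]_(t in D) (phi (F t) * beta_weight c c t * k t)%:E <= C%:E * I a b)%E.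
Proof.
move=> mD D01 mk C0 k01 wC.
apply: (@le_trans _ _ (\int[leb]_(t in `]0%R, 1%R[)
    (C%:E * (beta_weight a b t * phi (F t))%:E))%E); last first.
  rewrite ge0_integralZl//.
  - apply/measurable_EFinP; apply: measurable_funM; last exact: mphiF.
    exact: measurable_beta_weight.
  - by move=> t _; rewrite lee_fin mulr_ge0// beta_weight_ge0.
have mW E : measurable_fun E (fun t => (C%:E * (beta_weight a b t * phi (F t))%:E))%E.
  apply: measurable_funeM; apply/measurable_EFinP; apply: measurable_funM.
    exact: measurable_beta_weight.
  exact: mphiF.
apply: (@le_trans _ _ (\int[leb]_(t in D)
    (C%:E * (beta_weight a b t * phi (F t))%:E))%E); last first.
  apply: ge0_subset_integral => //; first exact: mW.
  by move=> t _; rewrite -EFinM lee_fin !mulr_ge0// beta_weight_ge0.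
apply: ge0_le_integral => //.
- move=> t Dt; have /andP[k0 _] := k01 _ Dt.
  by rewrite lee_fin !mulr_ge0// beta_weight_ge0.
- apply/measurable_EFinP; apply: measurable_funM => //.
  by apply: measurable_funM; [exact: mphiF|exact: measurable_beta_weight].
- exact: mW.
- move=> t Dt; have /andP[k0 k1] := k01 _ Dt.
  rewrite -EFinM lee_fin; apply: (@le_trans _ _ (phi (F t) * beta_weight c c t)).
    by rewrite ler_piMr// mulr_ge0// beta_weight_ge0.
  by rewrite [leLHS]mulrC (mulrA C); apply: ler_wpM2r => //; exact: wC.
Qed.

(** The cutoff [e] keeps the substitution on a compact interval, away from the pole of [F]; the
    bound does not depend on it. *)
Let int_left a b (e : R) : 0 < e < 2^-1 ->
  (\int[leb]_(v in `[4%R, F e]) (G a v)%:E <= (expR (`|a - b| * ln 2))%:E * I a b)%E.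
Proof.
move=> /andP[e0 e2].
(* 4 is the minimum of [F] on (0, 1), which is why the tails start there. *)
have F2 : F 2^-1 = 4 by rewrite /F; field.
have half : (2^-1 : R) < 1 by rewrite invf_lt1// ltr1n.
have e1 : e < 1 by exact: lt_trans half.
have in01 (t : R) : t \in `[e, 2^-1]%R -> 0 < t < 1.
  rewrite in_itv/= => /andP[t1 t2].
  by rewrite (lt_le_trans e0 t1) (le_lt_trans t2 half).
have ein : e \in `[e, 2^-1]%R by rewrite in_itv/= lexx ltW.
have hin : 2^-1 \in `[e, 2^-1]%R by rewrite in_itv/= lexx ltW.
have oo t : t \in `]e, 2^-1[%R -> t \in `[e, 2^-1]%R by exact: subset_itvW.
rewrite -{1}F2 integration_by_substitution_decreasing; first last.
- by apply: within_G; rewrite F2.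
- split.
  + by move=> t /oo/in01 t01; have [] := is_derive_F t01.
  + by apply: cvg_at_right_filter; apply: continuous_F; exact: in01.
  + by apply: cvg_at_left_filter; apply: continuous_F; exact: in01.
- apply/cvg_ex; exists (F^`() 2^-1); apply: cvg_at_left_filter.
  by apply: continuous_dF; exact: in01.
- apply/cvg_ex; exists (F^`() e); apply: cvg_at_right_filter.
  by apply: continuous_dF; exact: in01.
- by move=> t /oo/in01 t01; exact: continuous_dF.
- move=> x y xin yin xy; apply: F_lt; rewrite ?in01//.
  move: xin yin; rewrite !in_itv/= => /andP[_ x2] /andP[_ y2].
  by rewrite mulr_gt0// ?subr_gt0//; lra.
- exact: ltW.
rewrite [leLHS](_ : _ = (\int[leb]_(t in `[e, 2^-1%R])
    (phi (F t) * beta_weight a a t * (1 - 2 * t))%:E)%E); last first.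
  apply: eq_integral => t; rewrite inE/= => /in01 t01; congr EFin.
  rewrite -[LHS]/(G a (F t) * - derive1 F t).
  rewrite deriveF// /dF opprK mulrCA [RHS]mulrC; congr (_ * _).
  exact: G_F.
apply: sub_bound => //.
- by apply: measurable_funB => //; exact: measurable_funM.
- move=> t; rewrite /= in_itv/= => /andP[t1 t2]; apply/andP; split; lra.
- move=> t; rewrite /= in_itv/= => /andP[t1 t2].
  rewrite /beta_weight mulrCA ler_wpM2l ?expR_ge0// ln2B//.
  by apply/andP; split; lra.
Qed.

Let int_right a b (e : R) : 0 < e < 2^-1 ->
  (\int[leb]_(v in `[4%R, F e]) (G b v)%:E <= (expR (`|b - a| * ln 2))%:E * I a b)%E.
Proof.
move=> /andP[e0 e2].
have F2 : F 2^-1 = 4 by rewrite /F; field.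
(* By symmetry the same upper limit is reached from the right half, where [F] increases. *)
have Fe : F e = F (1 - e) by rewrite /F subKr mulrC.
have half : (2^-1 : R) < 1 by rewrite invf_lt1// ltr1n.
have half0 : (0 : R) < 2^-1 by rewrite invr_gt0.
have e1 : 2^-1 < 1 - e by lra.
have in01 (t : R) : t \in `[2^-1, 1 - e]%R -> 0 < t < 1.
  rewrite in_itv/= => /andP[t1 t2].
  by rewrite (lt_le_trans half0 t1)/=; lra.
have ein : 1 - e \in `[2^-1, 1 - e]%R by rewrite in_itv/= lexx ltW.
have hin : 2^-1 \in `[2^-1, 1 - e]%R by rewrite in_itv/= lexx ltW.
have oo t : t \in `]2^-1, 1 - e[%R -> t \in `[2^-1, 1 - e]%R by exact: subset_itvW.
rewrite Fe -{1}F2 integration_by_substitution_increasing; first last.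
- by apply: within_G; rewrite F2.
- split.
  + by move=> t /oo/in01 t01; have [] := is_derive_F t01.
  + by apply: cvg_at_right_filter; apply: continuous_F; exact: in01.
  + by apply: cvg_at_left_filter; apply: continuous_F; exact: in01.
- apply/cvg_ex; exists (F^`() (1 - e)); apply: cvg_at_left_filter.
  by apply: continuous_dF; exact: in01.
- apply/cvg_ex; exists (F^`() 2^-1); apply: cvg_at_right_filter.
  by apply: continuous_dF; exact: in01.
- by move=> t /oo/in01 t01; exact: continuous_dF.
- move=> x y xin yin xy; apply: F_lt; rewrite ?in01//.
  move: xin yin; rewrite !in_itv/= => /andP[x2 _] /andP[y2 _].
  by rewrite nmulr_rgt0 ?subr_lt0//; lra.
- exact: ltW.
rewrite [leLHS](_ : _ = (\int[leb]_(t in `[2^-1%R, (1 - e)%R])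
    (phi (F t) * beta_weight b b t * (2 * t - 1))%:E)%E); last first.
  apply: eq_integral => t; rewrite inE/= => /in01 t01; congr EFin.
  rewrite -[LHS]/(G b (F t) * derive1 F t).
  rewrite deriveF// /dF -mulNr opprB mulrCA [RHS]mulrC; congr (_ * _).
  exact: G_F.
apply: sub_bound => //.
- by apply: measurable_funB => //; exact: measurable_funM.
- move=> t; rewrite /= in_itv/= => /andP[t1 t2]; apply/andP; split; lra.
- move=> t; rewrite /= in_itv/= => /andP[t1 t2].
  rewrite /beta_weight mulrA ler_wpM2r ?expR_ge0// ln2B//.
  by apply/andP; split; lra.
Qed.

(** Monotone convergence along [4, n + 4] removes the cutoff. *)
Let int_tail c (B : \bar R) :
  (forall e : R, 0 < e < 2^-1 -> (\int[leb]_(v in `[4%R, F e]) (G c v)%:E <= B)%E) ->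
  (\int[leb]_(v in `[4%R, +oo[) (G c v)%:E <= B)%E.
Proof.
move=> hB; pose S (n : nat) : set R := `[4, n%:R + 4]%classic.
have mphi : measurable_fun setT phi by exact: continuous_measurable_fun.
have mG D : measurable_fun D (fun v => (G c v)%:E).
  apply/measurable_EFinP; apply: measurable_funTS; apply: measurable_funM => //.
  apply: (measurableT_comp (@measurable_expR R)).
  by apply: measurable_funM; [exact: measurable_cst|exact: measurable_ln].
have G0 v : (0 <= (G c v)%:E)%E by rewrite lee_fin mulr_ge0// expR_ge0.
have -> : `[4%R, +oo[%classic = \bigcup_n S n.
  apply/seteqP; split => v /=.
    rewrite in_itv/= andbT => v4.
    exists (Num.truncn v).+1 => //; rewrite /S/= in_itv/= v4/=.
    have := ltW (truncnS_gt v); rewrite -addn1 natrD => h; lra.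
  by move=> [n _]; rewrite /S /= !in_itv/= => /andP[->].
have mS n : measurable (S n) by exact: measurable_itv.
have cS : (\int[leb]_(v in S n) (G c v)%:E)%E @[n --> \oo] -->
    (\int[leb]_(v in \bigcup_n S n) (G c v)%:E)%E.
  apply: ge0_nondecreasing_set_cvg_integral => [|//|n|n v _]; [|exact: mG|exact: G0].
  apply/nondecreasing_seqP => n; apply/subsetPset => v.
  rewrite /S/= !in_itv/= => /andP[-> /=] h; apply: le_trans h _.
  by rewrite lerD2r ler_nat.
rewrite -(cvg_lim _ cS)//; apply: lime_le; first by apply/cvg_ex; eexists; exact: cS.
(* The cutoff e = 1 / m works: F (1 / m) = m / (1 - 1 / m) >= m, and m >= 4 makes e < 1/2. *)
apply: nearW => n; set m : R := n%:R + 4.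
have m4 : 4 <= m by rewrite lerDr.
have m0 : 0 < m by apply: lt_le_trans m4.
have m01 : 0 < m^-1 < 2^-1.
  rewrite invr_gt0 m0/= ltf_pV2 ?posrE//.
  by apply: lt_le_trans m4; rewrite ltr_nat.
apply: le_trans (hB _ m01); apply: ge0_subset_integral.
- exact: mS.
- exact: measurable_itv.
- exact: mG.
- by move=> v _; exact: G0.

move=> v; rewrite /S /= !in_itv/= => /andP[-> /=] h; apply: le_trans h _.
rewrite /F invfM invrK -/m ler_peMr ?(ltW m0)//.
have /andP[k0 k1] := m01.
have k2 : 2^-1 < (1 : R) by rewrite invf_lt1// ltr1n.
by rewrite invf_ge1 ?subr_gt0 ?(lt_trans k1 k2)// gerBl ltW.
Qed.

(* [v = 1 / (t (1 - t))] maps each half of [(0, 1)] onto [(4, +oo)]; the left half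
   controls the exponent [a], the right half the exponent [b]. *)
Lemma tail_integral_lty a b :
  (\int[leb]_(t in `]0%R, 1%R[)
    (beta_weight a b t * phi (t * (1 - t))^-1)%:E < +oo)%E ->
  (\int[leb]_(v in `[4%R, +oo[) (phi v * expR (- (a + 1) * ln v))%:E < +oo)%E /\
  (\int[leb]_(v in `[4%R, +oo[) (phi v * expR (- (b + 1) * ln v))%:E < +oo)%E.
Proof.
move=> Ioo; have CI x : ((expR x)%:E * I a b < +oo)%E.
  by apply: lte_mul_pinfty => //; rewrite lee_fin expR_ge0.
split; [apply: le_lt_trans (CI _); apply: int_tail => e; exact: int_left|].
by apply: le_lt_trans (CI _); apply: int_tail => e; exact: int_right.
Qed.

End tent_substitution.

(** * The kernel in [t] left by the scaling, and its integral *)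

Section kernel.
Context (R : realType) (a b c : R).
Hypotheses (a0 : 0 < a) (b0 : 0 < b) (c0 : 0 < c).
Local Notation leb := (@lebesgue_measure R).

(** The factor t (1 - t) is the Jacobian of rho = t (1 - t) v. It raises the exponents a - 1 and b -
    1 to [a] and [b], which are positive, so the kernel is bounded. *)
Let k (t v : R) : R :=
  beta_weight a b t * (t * (1 - t)) * expR (- (c * (t * (1 - t)) * v)).

Let weightE (t : R) : 0 < t < 1 ->
  beta_weight a b t * (t * (1 - t)) = expR (a * ln t) * expR (b * ln (1 - t)).
Proof.
move=> /andP[t0 t1]; have t1' : 0 < 1 - t by rewrite subr_gt0.
have -> : a * ln t = (a - 1) * ln t + ln t by ring.
have -> : b * ln (1 - t) = (b - 1) * ln (1 - t) + ln (1 - t) by ring.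
by rewrite !expRD !lnK ?posrE// /beta_weight mulrACA.
Qed.

Lemma kernel_ge0 (t v : R) : 0 < t < 1 -> 0 <= k t v.
Proof.
by move=> t01; rewrite /k weightE// !mulr_ge0 ?expR_ge0.
Qed.

Let exp_ln_le1 (x s : R) : 0 < x -> s <= 1 -> expR (x * ln s) <= 1.
Proof. by move=> x0 s1; rewrite -expR0 ler_expR pmulr_rle0// ln_le0. Qed.

Let kernel_le1 (t v : R) : 0 < t < 1 -> 0 <= v -> k t v <= 1.
Proof.
move=> t01 v0; have /andP[t0 t1] := t01.
have e1 : expR (- (c * (t * (1 - t)) * v)) <= 1.
  have u0 : 0 <= t * (1 - t) by apply: mulr_ge0; [exact: ltW|rewrite subr_ge0 ltW].
  by rewrite -[leRHS]expR0 ler_expR oppr_le0 (mulr_ge0 (mulr_ge0 (ltW c0) u0) v0).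
rewrite /k weightE// mulr_ile1 ?mulr_ge0 ?expR_ge0//.
rewrite mulr_ile1 ?expR_ge0// ?exp_ln_le1// ?ltW// ?gtrDl ?oppr_lt0//.
Qed.

(** Since w >= s v / 2, exp (- c w) is at most the square of exp (- (c / 4) s v). One factor absorbs
    (s v)^x, so that s^x costs only C v^(-x); the other is kept for the integration in [t]. *)
Let exp_half (x C s v w : R) : 0 < x -> 0 < s -> 0 < v -> s * v / 2 <= w ->
  (forall z, 0 < z -> expR (x * ln z) * expR (- (c / 4 * z)) <= C) ->
  expR (x * ln s) * expR (- (c * w)) <= C * expR (- x * ln v) * expR (- (c / 4 * v * s)).
Proof.
move=> x0 s0 v0 sw hC.
have h1 : expR (- (c * w)) <= expR (- (c / 4 * (s * v))) * expR (- (c / 4 * v * s)).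
  rewrite -expRD ler_expR.
  have := ler_wpM2l (ltW c0) sw; lra.
apply: le_trans (ler_wpM2l (expR_ge0 _) h1) _.
rewrite [leLHS]mulrA; apply: ler_wpM2r; first exact: expR_ge0.
have := hC _ (mulr_gt0 s0 v0); rewrite lnM ?posrE// mulrDr expRD.
have -> : expR (- x * ln v) = (expR (x * ln v))^-1 by rewrite mulNr expRN.
by rewrite ler_pdivlMr ?expR_gt0// [leLHS]mulrAC.
Qed.

(* [t (1 - t) >= t / 2] for [t <= 1/2], and symmetrically. *)
Lemma kernel_pointwise : exists2 C : R, 0 <= C & forall t v : R, 0 < t < 1 -> 0 < v ->
  k t v <= C * expR (- a * ln v) * expR (- (c / 4 * v * t)) +
           C * expR (- b * ln v) * expR (- (c / 4 * v * (1 - t))).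
Proof.
have c4 : 0 < c / 4 by rewrite divr_gt0.
have [A A0 hA] := power_expRN_bound a0 c4.
have [B B0 hB] := power_expRN_bound b0 c4.
(* Each half needs only one of the two terms, with constant [A] or [B]; the other is nonnegative,
   and adding it gives a single bound on (0, 1). *)
exists (A + B); first exact: addr_ge0.
move=> t v t01 v0; have /andP[t0 t1] := t01.
have s0 : 0 < 1 - t by rewrite subr_gt0.
have v0' := ltW v0.
rewrite /k weightE// -(mulrA c).
have [t2|t2] := leP t 2^-1.
  apply: (@le_trans _ _ (A * expR (- a * ln v) * expR (- (c / 4 * v * t)))).
    apply: le_trans (exp_half a0 t0 v0 (_ : _ <= t * (1 - t) * v) hA).
      rewrite ler_wpM2r ?expR_ge0// ler_piMr ?expR_ge0//.
      by apply: exp_ln_le1 => //; lra.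
    have : 0 <= t * v * (2^-1 - t) by rewrite !mulr_ge0 ?(ltW t0)// subr_ge0.
    lra.
  rewrite -[leLHS]addr0 lerD// ?mulr_ge0 ?expR_ge0 ?addr_ge0//.
  by rewrite -!mulrA ler_wpM2r ?lerDl// mulr_ge0 ?expR_ge0.
apply: (@le_trans _ _ (B * expR (- b * ln v) * expR (- (c / 4 * v * (1 - t))))).
  apply: le_trans (exp_half b0 s0 v0 (_ : _ <= t * (1 - t) * v) hB).
    rewrite ler_wpM2r ?expR_ge0// ler_piMl ?expR_ge0//.
    by apply: exp_ln_le1 => //; lra.
  have : 0 <= (1 - t) * v * (t - 2^-1).
    by rewrite !mulr_ge0 ?(ltW s0)// subr_ge0 ltW.
  lra.
rewrite -[leLHS]add0r lerD// ?mulr_ge0 ?expR_ge0 ?addr_ge0//.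
by rewrite -!mulrA ler_wpM2r ?lerDr// mulr_ge0 ?expR_ge0.
Qed.

Lemma measurable_kernel :
  measurable_fun setT (fun p : measurableTypeR R * measurableTypeR R => k p.1 p.2).
Proof.
have m1 : measurable_fun setT (fun p : measurableTypeR R * measurableTypeR R => p.1).
  exact: measurable_fst.
have mt : measurable_fun setT
    (fun p : measurableTypeR R * measurableTypeR R => p.1 * (1 - p.1)).
  by apply: measurable_funM => //; exact: measurable_funB.
apply: measurable_funM.
  apply: measurable_funM; last exact: mt.
  exact: (measurableT_comp (@measurable_beta_weight R a b [set: R]) m1).
apply: (measurableT_comp (@measurable_expR R)).
apply: (measurableT_comp (@oppr_measurable R setT)).
apply: measurable_funM; last exact: measurable_snd.
by apply: measurable_funM.
Qed.

Let measurable_kernel1 (D : set R) v : measurable_fun D (fun t => (k t v)%:E).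
Proof.
apply/measurable_EFinP; apply: measurable_funTS.
exact: (measurable_fun_pair1 v measurable_kernel).
Qed.

Lemma integral_kernel_le1 (v : R) : 0 <= v ->
  (\int[leb]_(t in `]0%R, 1%R[) (k t v)%:E <= 1)%E.
Proof.
move=> v0; apply: (@le_trans _ _ (\int[leb]_(t in `]0%R, 1%R[) (cst 1 t))%E).
  apply: ge0_le_integral => //.
  - by move=> t; rewrite /= in_itv/= => t01; rewrite lee_fin kernel_ge0.
  - exact: measurable_kernel1.
  - by move=> t; rewrite /= in_itv/= => t01; rewrite lee_fin kernel_le1.
by rewrite integral_cst//= mul1e lebesgue_measure_itv/= lte01 sube0.
Qed.

Lemma integral_kernel_le : exists2 C : R, 0 <= C & forall v : R, 0 < v ->
  (\int[leb]_(t in `]0%R, 1%R[) (k t v)%:E <=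
   (C * (expR (- (a + 1) * ln v) + expR (- (b + 1) * ln v)))%:E)%E.
Proof.
have [C C0 hC] := kernel_pointwise.
(* Integrating the exponentials in [t] gives 1 / ((c / 4) v): the constant part goes here, and 1 / v
   into the powers of v. *)
exists (C * (c / 4)^-1); first by rewrite mulr_ge0// invr_ge0 divr_ge0// ltW.
move=> v v0; have cv : 0 < c / 4 * v by rewrite mulr_gt0// divr_gt0.
have mexp (h : R -> R) (D : set R) : measurable_fun D h ->
    measurable_fun D (fun t => (expR (- (c / 4 * v * h t)))%:E).
  move=> mh; apply/measurable_EFinP; apply: (measurableT_comp (@measurable_expR R)).
  apply: (measurableT_comp (@oppr_measurable R setT)).
  exact: measurable_funM.
have m1 D := mexp id D (@measurable_id _ _ D).
have m2 (D : set R) : measurable_fun D (fun t => (expR (- (c / 4 * v * (1 - t))))%:E).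
  by apply: mexp; exact: measurable_funB.
have A0 x : 0 <= C * expR x by rewrite mulr_ge0// expR_ge0.
apply: (@le_trans _ _ (\int[leb]_(t in `]0%R, 1%R[)
  ((C * expR (- a * ln v))%:E * (expR (- (c / 4 * v * t)))%:E +
   (C * expR (- b * ln v))%:E * (expR (- (c / 4 * v * (1 - t))))%:E))%E).
  apply: ge0_le_integral => //.
  - by move=> t; rewrite /= in_itv/= => t01; rewrite lee_fin kernel_ge0.
  - exact: measurable_kernel1.
  - by apply: emeasurable_funD; apply: measurable_funeM; [exact: m1|exact: m2].
  - move=> t; rewrite /= in_itv/= => t01.
    by rewrite -!EFinM -EFinD lee_fin hC.
rewrite ge0_integralD//; last 4 first.
- by move=> t _; rewrite -EFinM lee_fin mulr_ge0// expR_ge0.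
- by apply: measurable_funeM; exact: m1.
- by move=> t _; rewrite -EFinM lee_fin mulr_ge0// expR_ge0.
- by apply: measurable_funeM; exact: m2.
rewrite ge0_integralZl ?lee_fin//; last exact: m1.
rewrite ge0_integralZl ?lee_fin//; last exact: m2.
have hv x : C * expR (- x * ln v) * (c / 4 * v)^-1 =
    C * (c / 4)^-1 * expR (- (x + 1) * ln v).
  have -> : - (x + 1) * ln v = - x * ln v - ln v by ring.
  by rewrite expRD expRN lnK ?posrE// invfM; ring.
rewrite mulrDr EFinD -!hv !EFinM; apply: leeD.
  by apply: lee_wpmul2l (integral_expR_left cv); rewrite -EFinM lee_fin.
by apply: lee_wpmul2l (integral_expR_right cv); rewrite -EFinM lee_fin.
Qed.

End kernel.

Lemma integral_scale (R : realType) (G : R -> R) (u : R) : 0 < u ->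
  continuous G -> (forall r, 0 <= G r) ->
  (\int[@lebesgue_measure R]_(r in `]0%R, +oo[) (G r)%:E =
   \int[@lebesgue_measure R]_(v in `]0%R, +oo[) (G (u * v) * u)%:E)%E.
Proof.
move=> u0 cG G0.
have dF (v : R) : is_derive v (1 : R) ( *%R u) u.
  by apply: is_derive_eq; rewrite /GRing.scale/= mulr1.
have cF : continuous ( *%R u) by move=> v; exact: is_derive_continuous (dF v).
have dE : ( *%R u)^`() = cst u.
  by apply/funext => v; rewrite derive1E; have [_ ->] := dF v.
rewrite integral_itv_obnd_cbnd; last exact: continuous_measurable_EFin.
rewrite integral_itv_obnd_cbnd; last first.
  apply: continuous_measurable_EFin => v; apply: cvgM; last exact: cvg_cst.
  by apply: continuous_comp; [exact: cF|exact: cG].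
have := @increasing_ge0_integration_by_substitutiony R ( *%R u) G 0.
rewrite mulr0 => ->.
- by rewrite dE.
- by move=> x y _ _ xy; rewrite ltr_pM2l.
- by rewrite dE => v _; exact: cvg_cst.
- by rewrite dE; apply/cvg_ex; exists u; exact: cvg_cst.
- by rewrite dE; apply/cvg_ex; exists u; exact: cvg_cst.
- split; first by move=> v _; have [] := dF v.
  by apply: cvg_at_right_filter; exact: cF.
- exact: gt0_cvgMry.
- exact: continuous_subspaceT.
- by move=> v _; exact: G0.
Qed.

(** * Finiteness of the double integral of the modulus *)

Section double_integral.
Context (R : realType) (a b c : R).
Hypotheses (a0 : 0 < a) (b0 : 0 < b) (c0 : 0 < c).
Variables (phi : R -> R) (cphi : continuous phi) (phi0 : forall v, 0 <= phi v).
Local Notation leb := (@lebesgue_measure R).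

Let k (t v : R) : R :=
  beta_weight a b t * (t * (1 - t)) * expR (- (c * (t * (1 - t)) * v)).

Let K (v : R) : \bar R := (\int[leb]_(t in `]0%R, 1%R[) (k t v)%:E)%E.

Let mD1 : measurable (`]0, 1[ : set R). Proof. exact: measurable_itv. Qed.
Let mD2 : measurable (`]0, +oo[ : set R). Proof. exact: measurable_itv. Qed.

Let mK (D : set R) : measurable_fun D K.
Proof.
apply: measurable_funTS; rewrite /K.
apply: (measurable_integral_ge0 _ (f := fun v t => k t v)) => //.
- have mswap : measurable_fun setT
      (fun p : measurableTypeR R * measurableTypeR R => (p.2, p.1)).
    by apply: measurable_fun_pair; [exact: measurable_snd|exact: measurable_fst].
  exact: (measurableT_comp (measurable_kernel a b c) mswap).
- by move=> v t; rewrite /= in_itv/= => t01; exact: kernel_ge0.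
Qed.

Let K_ge0 v : (0 <= K v)%E.
Proof.
apply: integral_ge0 => t; rewrite /= in_itv/= => t01.
by rewrite lee_fin kernel_ge0.
Qed.

Let mphi (D : set R) : measurable_fun D (fun v => (phi v)%:E).
Proof. exact: continuous_measurable_EFin. Qed.

Let mphiK (D : set R) : measurable_fun D (fun v => ((phi v)%:E * K v)%E).
Proof. exact: emeasurable_funM. Qed.

Let phiK_ge0 v : (0 <= (phi v)%:E * K v)%E.
Proof. by rewrite mule_ge0// lee_fin. Qed.

(** 1 / (t (1 - t)) takes no value below 4, so the M-beta integral says nothing here; [K <= 1] and
    continuity of [phi] on the compact [0, 4] replace it. *)
Let near_zero : (\int[leb]_(v in `]0%R, 4%R[) ((phi v)%:E * K v) < +oo)%E.
Proof.
apply: (@le_lt_trans _ _ (\int[leb]_(v in `[0%R, 4%R]) (phi v)%:E)%E).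
  apply: (@le_trans _ _ (\int[leb]_(v in `]0%R, 4%R[) (phi v)%:E)%E).
    apply: ge0_le_integral.
    - exact: measurable_itv.
    - by move=> v _; exact: phiK_ge0.
    - exact: mphiK.
    - exact: mphi.
    - move=> v; rewrite /= in_itv/= => /andP[v0 _].
      rewrite -[leRHS]mule1; apply: lee_wpmul2l; first by rewrite lee_fin.
      by apply: integral_kernel_le1 => //; exact: ltW.
  apply: ge0_subset_integral.
  - exact: measurable_itv.
  - exact: measurable_itv.
  - exact: mphi.
  - by move=> v _; rewrite lee_fin.
  - exact: subset_itvW.
have /integrableP[_] : leb.-integrable `[0%R, 4%R] (EFin \o phi).
  apply: continuous_compact_integrable; first exact: segment_compact.
  exact: continuous_subspaceT.
by under eq_integral do rewrite /= ger0_norm//.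
Qed.

Hypothesis Ioo : (\int[leb]_(t in `]0%R, 1%R[)
  (beta_weight a b t * phi (t * (1 - t))^-1)%:E < +oo)%E.

Let near_infty : (\int[leb]_(v in `[4%R, +oo[) ((phi v)%:E * K v) < +oo)%E.
Proof.
have [Ta Tb] := tail_integral_lty cphi phi0 Ioo.
have [C C0 hC] := integral_kernel_le a0 b0 c0.
have mT x (D : set R) : measurable_fun D (fun v => (phi v * expR (- (x + 1) * ln v))%:E).
  apply/measurable_EFinP; apply: measurable_funTS; apply: measurable_funM.
    exact: continuous_measurable_fun.
  apply: (measurableT_comp (@measurable_expR R)).
  by apply: measurable_funM; [exact: measurable_cst|exact: measurable_ln].
have T0 x v : (0 <= (phi v * expR (- (x + 1) * ln v))%:E)%E.
  by rewrite lee_fin mulr_ge0// expR_ge0.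
apply: (@le_lt_trans _ _ (\int[leb]_(v in `[4%R, +oo[)
  (C%:E * ((phi v * expR (- (a + 1) * ln v))%:E +
           (phi v * expR (- (b + 1) * ln v))%:E)))%E).
  apply: ge0_le_integral.
  - exact: measurable_itv.
  - by move=> v _; exact: phiK_ge0.
  - exact: mphiK.
  - by apply: measurable_funeM; apply: emeasurable_funD; exact: mT.
  - move=> v; rewrite /= in_itv/= andbT => v4.
    have v0 : 0 < v by apply: lt_le_trans v4.
    apply: le_trans (lee_wpmul2l _ (hC _ v0)) _; first by rewrite lee_fin.
    by rewrite -EFinD -!EFinM lee_fin le_eqVlt; apply/orP; left; apply/eqP; ring.
rewrite ge0_integralZl//; last 2 first.
- by apply: emeasurable_funD; exact: mT.
- by move=> v _; exact: adde_ge0.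
apply: lte_mul_pinfty => //.
rewrite ge0_integralD; first by apply: lte_add_pinfty; [exact: Ta|exact: Tb].
- exact: measurable_itv.
- by move=> v _; exact: T0.
- exact: mT.
- by move=> v _; exact: T0.
- exact: mT.
Qed.

Lemma laplace_beta_lty :
  (\int[leb]_(t in `]0%R, 1%R[) \int[leb]_(r in `]0%R, +oo[)
    (expR (- (c * r)) * (beta_weight a b t * phi (r / (t * (1 - t)))))%:E < +oo)%E.
Proof.
have cexp0 : continuous (fun r : R => expR (- (c * r))).
  rewrite (_ : (fun r => _) = (fun r => expR (- c * r + 0))).
    exact: continuous_expR_affine.
  by apply/funext => r; rewrite addr0 mulNr.
have inner t : 0 < t < 1 -> (\int[leb]_(r in `]0%R, +oo[)
    (expR (- (c * r)) * (beta_weight a b t * phi (r / (t * (1 - t)))))%:E =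
    \int[leb]_(v in `]0%R, +oo[) (phi v * k t v)%:E)%E.
  move=> /andP[t0 t1].
  have u0 : 0 < t * (1 - t) by rewrite mulr_gt0// subr_gt0.
  rewrite (integral_scale (G := fun r => expR (- (c * r)) *
      (beta_weight a b t * phi (r / (t * (1 - t))))) u0).
  - apply: eq_integral => v _; congr EFin.
    have -> : t * (1 - t) * v / (t * (1 - t)) = v.
      by rewrite mulrAC divff ?gt_eqF// mul1r.
    rewrite /k -[X in _ = _ * (_ * expR (- X))]mulrA.
    by move: (expR _) (beta_weight a b t) (phi v) => x1 x2 x3; ring.
  - move=> r; apply: cvgM; first exact: cexp0.
    apply: cvgM; first exact: cvg_cst.
    apply: continuous_comp; last exact: cphi.
    by apply: cvgM; [exact: cvg_id|exact: cvg_cst].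
  - by move=> r; rewrite !mulr_ge0 ?expR_ge0 ?beta_weight_ge0.
under eq_integral => t.
  rewrite inE/= in_itv/= => t01; rewrite inner//.
  over.
rewrite (integral_exchange_ge0 mD1 mD2 (f := fun t v => phi v * k t v)); last 2 first.
- apply: measurable_funM; last exact: measurable_kernel.
  apply: (measurableT_comp (continuous_measurable_fun cphi)).
  exact: measurable_snd.
- move=> t v; rewrite /= in_itv/= => t01 _; rewrite mulr_ge0//.
  exact: kernel_ge0.
have U : `]0, 4[ `|` `[4, +oo[ = `]0, +oo[ :> set R.
  by rewrite -itv_bndbnd_setU// bnd_simp.
rewrite (_ : (\int[leb]_(v in _) _)%E =
    (\int[leb]_(v in `]0%R, 4%R[ `|` `[4%R, +oo[) ((phi v)%:E * K v))%E); last first.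
  rewrite U; apply: eq_integral => v _.
  under eq_integral do rewrite EFinM.
  rewrite ge0_integralZl//.
  - apply/measurable_EFinP; apply: measurable_funTS.
    exact: (measurable_fun_pair1 v (measurable_kernel a b c)).
  - by move=> t; rewrite /= in_itv/= => t01; rewrite lee_fin kernel_ge0.
  - by rewrite lee_fin.
rewrite ge0_integral_setU.
- by apply: lte_add_pinfty; [exact: near_zero|exact: near_infty].
- exact: measurable_itv.
- exact: measurable_itv.
- exact: mphiK.
- by move=> v _; exact: phiK_ge0.
apply/disj_setPS => v [] /=; rewrite !in_itv/= andbT => /andP[_ h1] h2.
by move: (lt_le_trans h1 h2); rewrite ltxx.
Qed.

End double_integral.

(** * Values of the Gamma function *)

Section Gamma_nat.
Context (R : realType).

Lemma cpow_nat (n m : nat) : (0 < n)%N ->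
  cpow (n%:R : R) m%:R = (n%:R ^+ m)%:C.
Proof.
move=> n0; have m_real : (m%:R : R[i]) = (m%:R : R)%:C by rewrite rmorph_nat.
rewrite /cpow m_real -rmorphM; apply: complex_eqP.
  rewrite Re_cexp/= cos0 mulr1 mulrC expRM_natl lnK//.
  by rewrite posrE ltr0n.
by rewrite Im_cexp/= sin0 mulr0.
Qed.

Lemma prod_natD_fact (m n : nat) :
  \prod_(k < n) (m.+1%:R + k%:R) = ((n + m)`!%:R / m`!%:R : R).
Proof.
elim: n => [|n IH].
  by rewrite big_ord0 add0n divff// pnatr_eq0 -lt0n fact_gt0.
rewrite big_ord_recr/= IH addSn factS natrM -natrD.
by rewrite addSn [(m + n)%N]addnC mulrAC [X in X / _]mulrC.
Qed.

(** Passing from m to m + 1 multiplies the ratio by (n + m + 1) / n = 1 + (m + 1) / n, which tends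
    to 1. *)
Lemma cvg_fact_ratio (m : nat) :
  ((n + m)`!%:R / (n`!%:R * n%:R ^+ m) : R) @[n --> \oo] --> (1 : R).
Proof.
elim: m => [|m IH].
  apply: cvg_near_cst; apply: nearW => n.
  by rewrite addn0 expr0 mulr1 divff// pnatr_eq0 -lt0n fact_gt0.
have h : (1 + m.+1%:R * n%:R^-1 : R) @[n --> \oo] --> (1 + m.+1%:R * 0 : R).
  apply: cvgD; first exact: cvg_cst.
  apply: cvgM; first exact: cvg_cst.
  by apply/gtr0_cvgV0; [near=> n; rewrite ltr0n; near: n; exact: nbhs_infty_gt|
    exact: cvgr_idn].
have IHh : ((n + m)`!%:R / (n`!%:R * n%:R ^+ m) * (1 + m.+1%:R * n%:R^-1) : R)
    @[n --> \oo] --> (1 : R).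
  by have := cvgM IH h; rewrite mulr0 addr0 mulr1; apply.
apply: cvg_trans IHh.
apply: near_eq_cvg; near=> n.
have n0 : (n%:R : R) != 0.
  by rewrite pnatr_eq0 -lt0n; near: n; exact: nbhs_infty_gt.
have f0 : (n`!%:R : R) != 0 by rewrite pnatr_eq0 -lt0n fact_gt0.
rewrite /= addnS factS natrM exprS -addnS natrD.
by field; rewrite f0 n0 expf_neq0.
Unshelve. all: by end_near. Qed.

(** At z = m + 1 the product in Gauss' limit is (n + m + 1)! / m!, so the n-th term is 1 / m! times
    the ratio of [cvg_fact_ratio] for m + 1. *)
Lemma Gamma_nat (m : nat) : Gamma (1 + m%:R : R[i]) = m`!%:R.
Proof.
have f0 : (m`!%:R : R) != 0 by rewrite pnatr_eq0 -lt0n fact_gt0.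
rewrite /Gamma (_ : rGamma _ = ((m`!%:R : R)^-1)%:C).
  by rewrite fmorphV invrK rmorph_nat.
have h : ((n + m.+1)`!%:R / (n`!%:R * n%:R ^+ m.+1) / m`!%:R : R) @[n --> \oo] -->
    ((m`!%:R : R)^-1).
  rewrite -[X in _ --> X]mul1r; apply: cvgM; last exact: cvg_cst.
  exact: cvg_fact_ratio.
rewrite /rGamma; apply: (cvg_lim (T := R[i]^o)); first exact: norm_hausdorff.
apply: cvg_trans (cvg_real_complex h).
apply: near_eq_cvg; near=> n.
(* At n = 0 the default [ln 0 = 0] makes [cpow] equal to 1 instead of a power of 0. *)
have n0 : (0 < n)%N by near: n; exact: nbhs_infty_gt.
rewrite nat1r cpow_nat//.
have -> : \prod_(k < n.+1) (m.+1%:R + k%:R : R[i]) =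
    ((n.+1 + m)`!%:R / m`!%:R : R)%:C.
  rewrite -prod_natD_fact rmorph_prod; apply: eq_bigr => k _.
  by rewrite rmorphD !rmorph_nat.
have -> : (n`!%:R : R[i]) = (n`!%:R : R)%:C by rewrite rmorph_nat.
rewrite -rmorphM -fmorphV -rmorphM; congr (_%:C).
by rewrite addSnnS mulrAC.
Unshelve. all: by end_near. Qed.

Lemma pochhammer1 (m : nat) : pochhammer (1 : R[i]) m = m`!%:R.
Proof.
rewrite /pochhammer Gamma_nat -[X in _ / Gamma X]addr0 (Gamma_nat 0).
by rewrite fact0 divr1.
Qed.

End Gamma_nat.

(** * The M-beta function *)

Section Mseries_coef.
Context (R : realType) (alpha beta : R[i]).
Implicit Types (kappa mu : seq R[i]).

Definition Mcoef kappa mu (m : nat) : R[i] :=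
  (\prod_(k <- kappa) pochhammer k m) / (\prod_(l <- mu) pochhammer l m)
  / Gamma (alpha * m%:R + beta).

Lemma Mseries_termE kappa mu z m :
  Mseries_term alpha beta kappa mu z m = Mcoef kappa mu m * z ^+ m.
Proof. by rewrite /Mseries_term /Mcoef -!mulrA [z ^+ m * _]mulrC. Qed.

Lemma Mcoef_rcons1 kappa mu m :
  Mcoef (rcons kappa 1) mu m = Mcoef kappa mu m * m`!%:R.
Proof.
rewrite /Mcoef -cats1 big_cat big_seq1/= pochhammer1 -!mulrA; congr (_ * _).
by rewrite [LHS]mulrC -!mulrA.
Qed.

Lemma series_Mseries kappa mu z n :
  series (Mseries_term alpha beta kappa mu z) n = powser_sum (Mcoef kappa mu) z n.
Proof. by apply: eq_bigr => m _; rewrite Mseries_termE. Qed.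

Lemma cvg_Mseries kappa mu z : Mseries_converges alpha beta kappa mu z ->
  cRe (powser_sum (Mcoef kappa mu) z n) @[n --> \oo] -->
    cRe (Mseries alpha beta kappa mu z) /\
  cIm (powser_sum (Mcoef kappa mu) z n) @[n --> \oo] -->
    cIm (Mseries alpha beta kappa mu z).
Proof.
by move=> /cvg_ReIm[c1 c2]; split; [move: c1|move: c2];
  under eq_fun do rewrite series_Mseries.
Qed.

(** The terms of a convergent series tend to 0. This is the form in which convergence at points of
    arbitrarily large modulus yields [laplace_coef]. *)
Lemma Mseries_term_bounded kappa mu z : Mseries_converges alpha beta kappa mu z ->
  exists C : R, forall m, normc (Mcoef kappa mu m) * normc z ^+ m <= C.
Proof.
move=> /cvg_series_cvg_0/cvg_ReIm[c1 c2].
have bnd (u : nat -> R) : u @ \oo --> 0 -> exists C : R, forall m, `|u m| <= C.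
  move=> u0; have /cvg_seq_bounded[M [_ hM]] : cvgn u by apply/cvg_ex; exists 0.
  by exists (M + 1) => m; apply: hM => //; rewrite ltrDl.
have [C1 h1] := bnd _ c1; have [C2 h2] := bnd _ c2.
exists (C1 + C2) => m.
rewrite -normcX -ComplexField.Normc.normcM -Mseries_termE.
by apply: le_trans (normc_le_ReIm _) _; exact: lerD.
Qed.

End Mseries_coef.

(** * The exchange of the two integrals for the M-beta function *)

Section main.
Context (R : realType) (kappa mu : seq R[i]) (alpha beta x y s : R[i]).
Hypotheses (hx : 0 < cRe x) (hy : 0 < cRe y) (hs : 0 < cRe s).
Hypothesis hL : forall rho : R, 0 < rho ->
  Mbeta_defined alpha beta kappa mu x y rho%:C.
Hypothesis hR : Mbeta_defined alpha beta (rcons kappa 1) mu x y (1 / s).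
Local Notation leb := (@lebesgue_measure R).

Let a := Mcoef alpha beta kappa mu.

Let sN0 : s != 0.
Proof. by apply/eqP => sE; move: hs; rewrite sE/= ltxx. Qed.

Let tent_gt0 (t : R) : 0 < t < 1 -> 0 < t * (1 - t).
Proof. by move=> /andP[t0 t1]; rewrite mulr_gt0// subr_gt0. Qed.

(* [-1 / (s t (1 - t))] is unbounded as [t] tends to 0, so the right-hand
   series has infinite radius of convergence. *)
Let laplace_coef_a : laplace_coef a.
Proof.
move=> r r0; pose q := normc (1 / s).
have q0 : 0 < q.
  rewrite lt_neqAle normc_ge0 andbT eq_sym; apply/eqP => /ComplexField.Normc.eq0_normc.
  by rewrite div1r => /eqP; rewrite invr_eq0 (negbTE sN0).
(* The argument of the series at [t] has modulus q / (t (1 - t)) >= q / t >= r; the minimum with 1/2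
   keeps [t] inside (0, 1). *)
pose t := Num.min (2^-1) (q / r).
have t01 : 0 < t < 1.
  rewrite lt_min invr_gt0 ltr0n divr_gt0//= gt_min invf_lt1//.
  by rewrite ltr1n.
have u0 := tent_gt0 t01; have /andP[t0 t1] := t01.
have [C hC] := Mseries_term_bounded (hR.1 t t01).
exists C => m; apply: le_trans (hC m); rewrite Mcoef_rcons1.
rewrite [leRHS](_ : _ = normc (a m) * m`!%:R * normc (Mbeta_arg (1 / s) t) ^+ m).
  rewrite ler_wpM2l ?mulr_ge0 ?normc_ge0//.
  rewrite lerXn2r ?nnegrE ?(ltW r0) ?normc_ge0//.
  rewrite /Mbeta_arg ComplexField.Normc.normcM ComplexField.Normc.normcV normcN.
  rewrite normc_real gtr0_norm// -/q ler_pdivlMr//.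
  apply: le_trans (_ : r * t <= _).
    by rewrite ler_wpM2l ?(ltW r0)// ler_piMr ?(ltW t0)// gerBl ltW.
  by rewrite -ler_pdivlMl// mulrC ge_min lexx orbT.
by rewrite (ComplexField.Normc.normcM (Mcoef _ _ _ _ _)) normc_nat.
Qed.

Let phi v := normc (powser_neg a v).

(** Both sides are limits of the same partial sums. From here on the series is replaced by
    [powser_neg], whose continuity makes the integrand [H] jointly measurable on the whole plane. *)
Let MseriesE (rho t : R) : 0 < rho -> 0 < t < 1 ->
  Mseries alpha beta kappa mu (Mbeta_arg rho%:C t) =
  powser_neg a (rho / (t * (1 - t))).
Proof.
move=> rho0 t01; have := (hL rho0).1 t t01.
have -> : Mbeta_arg rho%:C t = (- (rho / (t * (1 - t))))%:C.
  rewrite /Mbeta_arg; move: (t * (1 - t)) => u.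
  by rewrite -mulNr rmorphM fmorphV rmorphN.
move=> /cvg_Mseries[c1 c2].
have h1 := cvg_Re_powser_neg laplace_coef_a (v := rho / (t * (1 - t))).
have h2 := cvg_Im_powser_neg laplace_coef_a (v := rho / (t * (1 - t))).
by apply: complex_eqP; [exact: cvg_unique c1 h1|exact: cvg_unique c2 h2].
Qed.

Let w t : R[i] := cpow t (x - 1) * cpow (1 - t) (y - 1).

Let H (t r : R) : R[i] :=
  cexp (- s * r%:C) * (w t * powser_neg a (r / (t * (1 - t)))).

Let normc_w t : normc (w t) = beta_weight (cRe x) (cRe y) t.
Proof.
by rewrite ComplexField.Normc.normcM !normc_cpow !ReD !ReN/=.
Qed.

Let D1 : set R := `]0, 1[.
Let D2 : set R := `]0, +oo[.
Let mD1 : measurable D1. Proof. exact: measurable_itv. Qed.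
Let mD2 : measurable D2. Proof. exact: measurable_itv. Qed.

Let in_D1 t : D1 t -> 0 < t < 1. Proof. by rewrite /D1/= in_itv. Qed.
Let in_D2 r : D2 r -> 0 < r. Proof. by rewrite /D2/= in_itv/= andbT. Qed.

Let integrandE rho t : 0 < rho -> D1 t ->
  Mbeta_integrand alpha beta kappa mu x y rho%:C t =
  w t * powser_neg a (rho / (t * (1 - t))).
Proof. by move=> rho0 /in_D1 t01; rewrite /Mbeta_integrand MseriesE. Qed.

Let cintegrable1 rho : 0 < rho ->
  cintegrable D1 (fun t => w t * powser_neg a (rho / (t * (1 - t)))).
Proof.
move=> rho0; apply: eq_cintegrable (hL rho0).2 => // t Dt.
exact: integrandE.
Qed.

Let measurable_H :
  cmeasurable setT (fun p : measurableTypeR R * measurableTypeR R => H p.1 p.2).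
Proof.
have m1 : measurable_fun setT (fun p : measurableTypeR R * measurableTypeR R => p.1).
  exact: measurable_fst.
have m2 : measurable_fun setT (fun p : measurableTypeR R * measurableTypeR R => p.2).
  exact: measurable_snd.
have m1' : measurable_fun setT
    (fun p : measurableTypeR R * measurableTypeR R => 1 - p.1 : R).
  by apply: measurable_funB => //; exact: m1.
have mu' : measurable_fun setT
    (fun p : measurableTypeR R * measurableTypeR R => p.1 * (1 - p.1) : R).
  by apply: measurable_funM; [exact: m1|exact: m1'].
apply: cmeasurableM.
  apply: cmeasurable_cexp; apply: cmeasurableM; first exact: cmeasurable_cst.
  by apply: cmeasurable_real; exact: m2.
apply: cmeasurableM.
  apply: cmeasurableM; apply: cmeasurable_cpow; [exact: m1|exact: m1'].
apply: cmeasurable_powser_neg => //; apply: measurable_funM; first exact: m2.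
exact: (measurableT_comp (@measurable_invr R) mu').
Qed.

Let double_finite :
  (\int[leb]_(t in D1) \int[leb]_(r in D2) (normc (H t r))%:E < +oo)%E.
Proof.
have Ioo : (\int[leb]_(t in `]0%R, 1%R[)
    (beta_weight (cRe x) (cRe y) t * phi (t * (1 - t))^-1)%:E < +oo)%E.
  have /integrableP[_] := cintegrable_normc mD1 (cintegrable1 ltr01).
  congr (_ < _)%E; apply: eq_integral => t _.
  rewrite gee0_abs ?lee_fin ?normc_ge0// ComplexField.Normc.normcM normc_w.
  by rewrite div1r.
have HE t r : normc (H t r) = expR (- (cRe s * r)) *
    (beta_weight (cRe x) (cRe y) t * phi (r / (t * (1 - t)))).
  rewrite /H (ComplexField.Normc.normcM (cexp _)) normc_cexp_real.
  by rewrite (ComplexField.Normc.normcM (w t)) normc_w.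
under eq_integral do under eq_integral do rewrite HE.
exact: (laplace_beta_lty hx hy hs
  (continuous_normc_powser_neg laplace_coef_a) (fun v => normc_ge0 _) Ioo).
Qed.

Let cintegrable2 t : D1 t -> cintegrable D2 (H t).
Proof.
move=> /in_D1/tent_gt0 u0.
have [h _ _] := laplace_powser_neg laplace_coef_a hs u0.
apply: eq_cintegrable (cintegrableZ mD2 (w t) h) => // r _.
by rewrite /H mulrCA.
Qed.

(** Uniqueness of limits identifies the right-hand [Mseries] with [s] times the Laplace transform in
    [r]; the prefactor [1 / s] cancels that [s]. *)
Let cintegral2 t : D1 t -> cintegral D2 (H t) =
  1 / s * Mbeta_integrand alpha beta (rcons kappa 1) mu x y (1 / s) t.
Proof.
move=> /in_D1 t01; have u0 := tent_gt0 t01.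
have [h l1 l2] := laplace_powser_neg laplace_coef_a hs u0.
rewrite (@eq_cintegral _ _ _ (fun r => w t *
    (cexp (- s * r%:C) * powser_neg a (r / (t * (1 - t)))))); last first.
  by move=> r _; rewrite /H mulrCA.
rewrite cintegralZ// /Mbeta_integrand -/(w t).
have [c1 c2] := cvg_Mseries (hR.1 t t01).
have aE : Mcoef alpha beta (rcons kappa 1) mu = (fun m => a m * m`!%:R).
  by apply/funext => m; rewrite Mcoef_rcons1.
rewrite aE /Mbeta_arg in c1 c2.
rewrite /Mbeta_arg (_ : Mseries _ _ _ _ _ = s * cintegral D2
  (fun r => cexp (- s * r%:C) * powser_neg a (r / (t * (1 - t))))).
  by rewrite [in RHS]mulrCA mulrA; field.
by apply: complex_eqP; [exact: cvg_unique c1 l1|exact: cvg_unique c2 l2].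
Qed.

Lemma laplace_Mbeta :
  cintegrable D2
    (fun rho : R => cexp (- s * rho%:C) * Mbeta alpha beta kappa mu x y rho%:C)
  /\
  cintegral D2
    (fun rho : R => cexp (- s * rho%:C) * Mbeta alpha beta kappa mu x y rho%:C)
  = 1 / s * Mbeta alpha beta (rcons kappa 1) mu x y (1 / s).
Proof.
have inner r : D2 r -> cintegral D1 (H^~ r) =
    cexp (- s * r%:C) * Mbeta alpha beta kappa mu x y r%:C.
  move=> /in_D2 r0; rewrite /Mbeta /H cintegralZ//; last exact: cintegrable1.
  by congr (_ * _); apply: eq_cintegral => t Dt; rewrite integrandE.
have i1 r : D2 r -> cintegrable D1 (H^~ r).
  by move=> /in_D2 r0; apply: cintegrableZ => //; exact: cintegrable1.
(* Fubini also returns integrability of the inner integral, which is the claimed absolute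
   convergence of the Laplace integral in rho. *)
have [iF eF] := cintegral_exchange mD1 mD2 measurable_H double_finite i1 cintegrable2.
split; first exact: eq_cintegrable inner iF.
apply: etrans (esym (eq_cintegral inner)) _; apply: etrans eF _.
apply: etrans (eq_cintegral cintegral2) _.
exact: cintegralZ mD1 _ _ hR.2.
Qed.

End main.

Unset Implicit Arguments.
Local Close Scope classical_set_scope.

Theorem theorem3p2 (R : realType) (p q : nat)
    (kappa : p.-tuple R[i]) (mu : q.-tuple R[i])
    (alpha beta x y s : R[i])
    (hkappa : forall (i : 'I_p) (n : nat), tnth kappa i <> - n%:R)
    (hmu : forall (j : 'I_q) (n : nat), tnth mu j <> - n%:R)
    (halpha : 0 < complex.Re alpha)
    (hx : 0 < complex.Re x) (hy : 0 < complex.Re y) (hs : 0 < complex.Re s)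
    (hL : forall rho : R, 0 < rho ->
       Mbeta_defined alpha beta kappa mu x y rho%:C)
    (hR : Mbeta_defined alpha beta (rcons kappa 1) mu x y (1 / s)) :
  cintegrable `]0, +oo[%classic
    (fun rho : R => cexp (- s * rho%:C) * Mbeta alpha beta kappa mu x y rho%:C)
  /\
  cintegral `]0, +oo[%classic
    (fun rho : R => cexp (- s * rho%:C) * Mbeta alpha beta kappa mu x y rho%:C)
  = 1 / s * Mbeta alpha beta (rcons kappa 1) mu x y (1 / s).
Proof. exact: laplace_Mbeta. Qed.
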